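(* Let $\rho\in[0,1)$ and, for each $n$, let $(X_1,\ldots,X_n)$ be jointly normal with unit variances and $\operatorname{Corr}(X_i,X_j)=\rho$ for all $i\ne j$. Let $\alpha\in(0,1)$. 1. When $\rho=0$ (independent normal setup), $$\lim_{n\to\infty}FWER_{Hochberg}(n,\alpha,0)\in[1-e^{-\alpha},\alpha]$$ under the global null hypothesis. 2. When $\rho\in(0,1)$, $$\lim_{n\to\infty}FWER_{Hochberg}(n,\alpha,\rho)=0$$ for any $\alpha\in(0,1/2)$, under the global null hypothesis.
   Context: Testing problem: $X_i\sim\mathcal N(\mu_i,1)$; test $H_{0i}:\mu_i=0$ against $H_{1i}:\mu_i>0$, $1\le i\le n$. The global null hypothesis states that $\mu_i=0$ for all $i$. The p-values are $P_i=1-\Phi(X_i)$, with $\Phi$ the standard normal distribution function, and $P_{(1)}\le\cdots\le P_{(n)}$ are the ordered p-values, with corresponding null hypotheses $H_{(1)},\ldots,H_{(n)}$. For a multiple testing procedure $T$, $V_n(T)$ is the number of type I errors (rejected true nulls), and $FWER_T(n,\alpha,\rho)=\mathbb P(V_n(T)\ge1)$, the probability being computed under the equicorrelated model with correlation $\rho$. Hochberg's procedure at level $\alpha$ is the step-up procedure with cutoffs $u_i=\alpha/(n-i+1)$: it rejects $H_{(1)},\ldots,H_{(m)}$ where $m=\max\{i:P_{(i)}\le u_i\}$, and rejects nothing if no such $i$ exists. *)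

(* Defs.v *)
From HB Require Import structures.
From mathcomp Require Import all_boot all_order all_algebra.
From mathcomp Require Import all_classical all_reals all_analysis.

Set Implicit Arguments.
Unset Strict Implicit.
Unset Printing Implicit Defensive.

Import Order.TTheory GRing.Theory Num.Theory.
Import numFieldNormedType.Exports.

Local Open Scope classical_set_scope.
Local Open Scope ring_scope.

(* Normal law with mean m and standard deviation s >= 0. The case s = 0 is
   the point mass at m: the library's [normal_prob m 0] is not, it is the
   uniform law on [0, 1]. *)
Definition normal_law {R : realType} (m s : R) (A : set R) : \bar R :=
  if s == 0 then \d_m A else normal_prob m s A.

(* Y ~ N(m, s^2) *)
Definition has_normal_law {d : measure_display} {Om : measurableType d}
    {R : realType} (P : probability Om R) (Y : Om -> R) (m s : R) : Prop :=
  forall A : set R, measurable A -> P (Y @^-1` A) = normal_law m s A.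

(* Joint normality: every linear combination of the coordinates is normal,
   possibly degenerate (as it is for zero coefficients). *)
Definition jointly_normal {d : measure_display} {Om : measurableType d}
    {R : realType} (P : probability Om R) {n : nat}
    (X : 'I_n -> {RV P >-> R}) : Prop :=
  forall a : 'I_n -> R, exists m s : R,
    0 <= s /\ has_normal_law P (fun w => \sum_(i < n) a i * X i w) m s.
Arguments jointly_normal {d Om R} P {n} X.

Definition correlation {d : measure_display} {Om : measurableType d}
    {R : realType} (P : probability Om R) (Y Z : Om -> R) : R :=
  fine (covariance P Y Z) / Num.sqrt (fine 'V_P[Y] * fine 'V_P[Z]).

Definition equicorrelated_normal {d : measure_display}
    {Om : measurableType d} {R : realType} (P : probability Om R) {n : nat}
    (X : 'I_n -> {RV P >-> R}) (mu : 'I_n -> R) (rho : R) : Prop :=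
  [/\ jointly_normal P X,
      forall i, has_normal_law P (X i) (mu i) 1 &
      forall i j, i != j -> correlation P (X i) (X j) = rho].
Arguments equicorrelated_normal {d Om R} P {n} X mu rho.

Definition global_null {R : realType} {n : nat} (mu : 'I_n -> R) : Prop :=
  forall i, mu i = 0.

Definition Phi {R : realType} (x : R) : R :=
  fine (normal_prob 0 1 `]-oo, x]).

Definition pvalue {R : realType} (x : R) : R := 1 - Phi x.

(* A procedure maps the p-values of n hypotheses to the set of rejected ones. *)
Definition procedure (R : realType) (n : nat) : Type :=
  ('I_n -> R) -> {set 'I_n}.

(* The hypotheses H_(1), ..., H_(n), in nondecreasing order of p-value. *)
Definition ordered_hyps {R : realType} {n : nat} (p : 'I_n -> R) : seq 'I_n :=
  sort (fun i j => p i <= p j) (enum 'I_n).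

(* P_(i), numbered from 1; the default value 0 is not used for 1 <= i <= n. *)
Definition ordered_pvalue {R : realType} {n : nat} (p : 'I_n -> R)
    (i : nat) : R :=
  nth 0 (map p (ordered_hyps p)) i.-1.

(* max {i in 1..n : P_(i) <= u_i}, and 0 if there is no such i *)
Definition step_up_index {R : realType} {n : nat} (u : nat -> R)
    (p : 'I_n -> R) : nat :=
  \max_(1 <= i < n.+1 | ordered_pvalue p i <= u i) i.

Definition step_up {R : realType} {n : nat} (u : nat -> R) : procedure R n :=
  fun p => [set i in take (step_up_index u p) (ordered_hyps p)].

Definition hochberg {R : realType} (n : nat) (alpha : R) : procedure R n :=
  step_up (fun i => alpha / (n - i + 1)%:R).
Arguments hochberg {R} n alpha.

(* V_n(T), for observations x and true means mu *)
Definition type1_errors {R : realType} {n : nat} (T : procedure R n)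
    (mu x : 'I_n -> R) : nat :=
  #|[set i in T (fun j => pvalue (x j)) | mu i == 0]|.

Definition FWER {d : measure_display} {Om : measurableType d} {R : realType}
    (P : probability Om R) {n : nat} (X : 'I_n -> {RV P >-> R})
    (mu : 'I_n -> R) (T : procedure R n) : \bar R :=
  P [set w | (1 <= type1_errors T mu (fun i => X i w))%N].
Arguments FWER {d Om R} P {n} X mu T.

(* Main.v *)
(* Hochberg's procedure rejects something iff for some k in 1..n at least n - k + 1 of the
   p-values are <= alpha / k.

   Small k (k <= delta n) would put at least (1 - delta) n observations above a fixed tau.
   Write X_i = Xbar + Y_i, where Xbar is the sample mean. The averages of exp (- lam Y_i) and
   exp (- 2 lam Y_i) have explicit first and second moments, because every linear combination
   of the X_i is normal; the first concentrates at a value which, for lam large, contradicts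
   Xbar <= M and Y_i >= tau - M for all but delta n indices. So this regime is negligible for
   every rho < 1, and needs only one-dimensional laws.

   If rho > 0, the other k force max X_i > z for some z of order (1 - rho / 2) sqrt (2 ln n),
   whereas Xbar is bounded in probability and the Y_i have variance at most 1 - rho, so the
   union bound gives probability tending to 0.

   If rho = 0, the k between delta n and n / theta force a positive fraction of the
   observations to exceed any fixed level (Markov), and k >= n / theta forces
   max X_i > z with 1 - Phi z close to alpha / n. Together with the lower bound
   P (min P_i <= alpha / n) this gives the limit 1 - exp (- alpha). Here the X_i must be
   shown independent: their joint characteristic function is explicit, hence expectations of
   products of trigonometric functions of the coordinates factorize, and this extends to
   half-line indicators, which are iterated bounded limits of trigonometric polynomials. *)
Require Import Defs.
From HB Require Import structures.
From mathcomp Require Import all_boot all_order all_algebra.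
From mathcomp Require Import all_classical all_reals all_analysis.
From mathcomp Require Import measurable_realfun normal_distribution random_variable
  lebesgue_integral_under ring lra zify.
Import Order.TTheory GRing.Theory Num.Theory.
Import numFieldNormedType.Exports.
Local Open Scope classical_set_scope.
Local Open Scope ring_scope.

Set Implicit Arguments.
Unset Strict Implicit.
Unset Printing Implicit Defensive.

(** * The normal distribution *)

(** [normal_prob] is absolutely continuous, and its Radon-Nikodym derivative agrees almost
    everywhere with [normal_pdf] because both have the same integral over every measurable set. *)
Lemma ge0_integral_normal_prob {R : realType} (m s : R) (f : measurableTypeR R -> \bar R) :
  measurable_fun setT f -> (forall x, 0 <= f x)%E ->
  (\int[normal_prob m s]_x f x =
   \int[lebesgue_measure]_x (f x * (normal_pdf m s x)%:E))%E.
Proof.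
move=> mf f0.
have dom := normal_prob_dominates m s.
have mpdf : measurable_fun setT (fun x : R => (normal_pdf m s x)%:E).
  by apply/measurable_EFinP; exact: measurable_normal_pdf.
have rn := Radon_Nikodym_SigmaFinite.f_integrable dom.
rewrite -(Radon_Nikodym_SigmaFinite.change_of_variables dom)//.
apply: ae_eq_integral => //.
- by apply: emeasurable_funM => //; exact: (measurable_int _ rn).
- exact: emeasurable_funM.
- apply: ae_eqe_mul2l; apply: integral_ae_eq => // E _ mE.
  by rewrite -Radon_Nikodym_SigmaFinite.f_integral.
Qed.

(** Substitution along the increasing map [x |-> m + s * x]; its derivative [s] cancels against the
    peak of the density. *)
Lemma normal_prob_subst {R : realType} (m s : R) (f : R -> R) : 0 < s ->
  continuous f -> (forall x, 0 <= f x) ->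
  (\int[normal_prob m s]_x (f x)%:E =
   \int[normal_prob 0 1]_x (f (m + s * x))%:E)%E.
Proof.
move=> s0 cf f0.
have sn0 : s != 0 by rewrite gt_eqF.
have dF (x : R) : is_derive x 1 (fun y => m + s * y) s.
  by apply: is_derive_eq; rewrite add0r mul1r; exact: mulr1.
have F' : (fun y => m + s * y)^`()%classic = cst s.
  by apply/funext => x; rewrite derive1E; exact: derive_val.
have cF : continuous (fun y : R => m + s * y).
  move=> x; apply: cvgD; first exact: cvg_cst.
  by apply: cvgM; [exact: cvg_cst|exact: cvg_id].
have cpdf := @continuous_normal_pdf R m s sn0.
rewrite ge0_integral_normal_prob; last 2 first.
  by apply/measurable_EFinP; exact: continuous_measurable_fun.
  by move=> x; rewrite lee_fin.
rewrite ge0_integral_normal_prob; last 2 first.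
  apply/measurable_EFinP; apply: continuous_measurable_fun.
  by move=> x; apply: continuous_comp; [exact: cF|exact: cf].
  by move=> x; rewrite lee_fin.
under eq_integral do rewrite -EFinM.
rewrite (@increasing_ge0_integration_by_substitutionT _ (fun y => m + s * y)
  (fun x => f x * normal_pdf m s x)); first last.
- by move=> x; rewrite mulr_ge0// normal_pdf_ge0.
- by move=> x; apply: cvgM; [exact: cf|exact: cpdf].
- rewrite (_ : (fun _ => _) = (+%R^~ m) \o ( *%R^~ s)).
    apply: cvg_comp; last exact: cvg_addrr.
    by apply: gt0_cvgMly => //; exact: cvg_id.
  by apply/funext => x /=; rewrite addrC mulrC.
- rewrite (_ : (fun _ => _) = (+%R^~ m) \o ( *%R^~ s)).
    apply: cvg_comp; last exact: cvg_addrr_Ny.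
    by apply: gt0_cvgMlNy => //; exact: cvg_id.
  by apply/funext => x /=; rewrite addrC mulrC.
- by move=> x; exact: ex_derive.
- by rewrite F'; exact: is_cvg_cst.
- by rewrite F'; exact: is_cvg_cst.
- by rewrite F' => x; exact: cvg_cst.
- by move=> x y xy; rewrite ltrD2l ltr_pM2l.
apply: eq_integral => x _; rewrite F' !fctE -EFinM; congr (_%:E).
rewrite -mulrA; congr (_ * _).
rewrite !normal_pdfE ?oner_eq0// /normal_fun /normal_peak.
rewrite (_ : m + s * x - m = s * x) ?subr0; last by ring.
rewrite -mulrnAr sqrtrM ?sqr_ge0// sqrtr_sqr gtr0_norm// invfM expr1n mul1r.
have -> : - (s * x) ^+ 2 / (s ^+ 2 *+ 2) = - x ^+ 2 / 2 by field.
by rewrite mulrAC; congr (_ * _); rewrite mulrAC mulVf ?mul1r.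
Qed.

Lemma bounded_integrable {d} {T : measurableType d} {R : realType}
    (P : probability T R) (f : T -> R) (M : R) :
  measurable_fun setT f -> (forall x, `|f x| <= M) ->
  P.-integrable setT (EFin \o f).
Proof.
move=> mf fM; apply: (@le_integrable _ _ _ _ _ measurableT _ (EFin \o cst M)).
- exact/measurable_EFinP.
- move=> x _ /=; rewrite lee_fin (le_trans (fM x))// ler_norm//.
- exact: finite_measure_integrable_cst.
Qed.

Lemma integrable_addr {d} {T : measurableType d} {R : realType}
    (P : {measure set T -> \bar R}) (f g : T -> R) :
  P.-integrable setT (EFin \o f) -> P.-integrable setT (EFin \o g) ->
  P.-integrable setT (EFin \o (fun x => f x + g x)).
Proof. exact: integrableD. Qed.

Lemma integrable_scaler {d} {T : measurableType d} {R : realType}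
    (P : {measure set T -> \bar R}) (k : R) (f : T -> R) :
  P.-integrable setT (EFin \o f) ->
  P.-integrable setT (EFin \o (fun x => k * f x)).
Proof. by move=> intf; exact: (integrableZl measurableT k intf). Qed.

(** * Tilting and exponential moments of the standard normal law *)

Section standard_normal.
Context {R : realType}.
Notation gam := (normal_prob (0:R) 1).

(* Completing the square: multiplying the density by [expR (h * x)] recentres it at [h]. *)
Lemma gauss_tilt (h : R) (f : R -> R) :
  continuous f -> (forall x, 0 <= f x) ->
  (\int[gam]_x (f x * expR (h * x))%:E =
   (expR (h ^+ 2 / 2))%:E * \int[gam]_x (f (h + x))%:E)%E.
Proof.
move=> cf f0.
have := normal_prob_subst h ltr01 cf f0.
under [X in _ = X -> _]eq_integral do rewrite mul1r.
move=> <-.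
have cE : continuous (fun x : R => expR (h * x)).
  by move=> x; apply: continuous_comp; [exact: mulrl_continuous|exact: continuous_expR].
rewrite ge0_integral_normal_prob; last 2 first.
  apply/measurable_EFinP; apply: continuous_measurable_fun.
  by move=> x; apply: cvgM; [exact: cf|exact: cE].
  by move=> x; rewrite lee_fin mulr_ge0// expR_ge0.
rewrite ge0_integral_normal_prob; last 2 first.
  by apply/measurable_EFinP; exact: continuous_measurable_fun.
  by move=> x; rewrite lee_fin.
rewrite -ge0_integralZl//; last 2 first.
- apply: emeasurable_funM.
    by apply/measurable_EFinP; exact: continuous_measurable_fun.
  by apply/measurable_EFinP; exact: measurable_normal_pdf.
- by move=> x _; rewrite -EFinM lee_fin mulr_ge0// normal_pdf_ge0.
apply: eq_integral => x _; rewrite -!EFinM; congr (_%:E).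
rewrite -mulrA [RHS]mulrCA; congr (_ * _).
rewrite !normal_pdfE ?oner_eq0// /normal_fun mulrCA [RHS]mulrCA; congr (_ * _).
rewrite -!expRD; congr expR; by field.
Qed.

Lemma gauss_mgf (h : R) :
  (\int[gam]_x (expR (h * x))%:E = (expR (h ^+ 2 / 2))%:E)%E.
Proof.
have := @gauss_tilt h (cst 1) (fun=> cvg_cst _) (fun=> ler01).
under eq_integral do rewrite /= mul1r.
move=> ->; rewrite -[RHS]mule1; congr (_ * _)%E.
apply: (etrans (integral_cst gam measurableT 1%E)).
by rewrite mul1e; exact: (probability_setT gam).
Qed.

Lemma gauss_integrable_exp (h : R) :
  gam.-integrable setT (EFin \o (fun x => expR (h * x))).
Proof.
apply/integrableP; split.
  apply/measurable_EFinP; apply: continuous_measurable_fun.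
  by move=> x; apply: continuous_comp; [exact: mulrl_continuous|exact: continuous_expR].
under eq_integral do rewrite /= ger0_norm ?expR_ge0//.
by rewrite gauss_mgf ltry.
Qed.

Lemma measurable_cos_affine (a b : R) :
  measurable_fun setT (fun x : R => cos (a * x + b)).
Proof.
apply: continuous_measurable_fun => x.
apply: (@continuous_comp _ _ _ (fun x => a * x + b) cos); last exact: continuous_cos.
apply: cvgD; last exact: cvg_cst.
exact: mulrl_continuous.
Qed.

Lemma measurable_sin_affine (a b : R) :
  measurable_fun setT (fun x : R => sin (a * x + b)).
Proof.
apply: continuous_measurable_fun => x.
apply: (@continuous_comp _ _ _ (fun x => a * x + b) sin); last exact: continuous_sin.
apply: cvgD; last exact: cvg_cst.
exact: mulrl_continuous.
Qed.

Lemma cos_norm_le1 (x : R) : `|cos x| <= 1.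
Proof. by rewrite ler_norml cos_geN1 cos_le1. Qed.

Lemma sin_norm_le1 (x : R) : `|sin x| <= 1.
Proof. by rewrite ler_norml sin_geN1 sin_le1. Qed.

Lemma measurable_exp_scale (h : R) : measurable_fun setT (fun x : R => expR (h * x)).
Proof.
apply: continuous_measurable_fun => x.
by apply: continuous_comp; [exact: mulrl_continuous|exact: continuous_expR].
Qed.

Lemma gauss_integrable_cos (a b : R) :
  gam.-integrable setT (EFin \o (fun x => cos (a * x + b))).
Proof.
apply: (@bounded_integrable _ _ _ _ _ 1); first exact: measurable_cos_affine.
by move=> x; exact: cos_norm_le1.
Qed.

Lemma gauss_integrable_sin (a b : R) :
  gam.-integrable setT (EFin \o (fun x => sin (a * x + b))).
Proof.
apply: (@bounded_integrable _ _ _ _ _ 1); first exact: measurable_sin_affine.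
by move=> x; exact: sin_norm_le1.
Qed.

Lemma gauss_integrable_cos_exp (a b h : R) :
  gam.-integrable setT (EFin \o (fun x => cos (a * x + b) * expR (h * x))).
Proof.
apply: le_integrable (gauss_integrable_exp h) => //.
  apply/measurable_EFinP/measurable_funM; first exact: measurable_cos_affine.
  exact: measurable_exp_scale.
move=> x _; rewrite /= lee_fin normrM.
by rewrite ler_piMl// cos_norm_le1.
Qed.

(** [gauss_tilt] asks for a nonnegative integrand, so it is applied to [1 + cos]; the constant 1
    contributes the exponential moment to both sides and cancels. *)
Lemma gauss_tilt_cos (a b h : R) :
  \int[gam]_x (cos (a * x + b) * expR (h * x)) =
  expR (h ^+ 2 / 2) * \int[gam]_x (cos (a * x + (a * h + b))).
Proof.
have cf : continuous (fun x : R => 1 + cos (a * x + b)).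
  move=> x; apply: cvgD; first exact: cvg_cst.
  apply: (@continuous_comp _ _ _ (fun x => a * x + b) cos); last exact: continuous_cos.
  apply: cvgD; last exact: cvg_cst.
  exact: mulrl_continuous.
have f0 (x : R) : 0 <= 1 + cos (a * x + b) by rewrite -lerBlDl sub0r cos_geN1.
have := gauss_tilt h cf f0 => /(congr1 fine).
rewrite -/(Rintegral _ _ _).
under [X in X = _ -> _]eq_Rintegral do rewrite mulrDl mul1r.
rewrite RintegralD//; last 2 first.
- exact: gauss_integrable_exp.
- exact: gauss_integrable_cos_exp.
have E x : a * (h + x) + b = a * x + (a * h + b) by ring.
under eq_integral do rewrite E.
rewrite fineM//; last first.
  apply: integrable_fin_num => //.
  apply: (@bounded_integrable _ _ _ _ _ 2).
    by apply: measurable_funD => //; exact: measurable_cos_affine.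
  move=> x; rewrite (le_trans (ler_normD _ _))// normr1.
  by rewrite (_ : 2 = 1 + 1)// lerD2l cos_norm_le1.
rewrite -/(Rintegral _ _ _) RintegralD//; last 2 first.
- exact: finite_measure_integrable_cst.
- exact: gauss_integrable_cos.
have g1 : \int[gam]_x (1 : R) = 1.
  apply: (etrans (Rintegral_cst gam measurableT 1)).
  by rewrite mul1r; exact: (congr1 fine (probability_setT gam)).
rewrite g1 mulrDr mulr1 {1}/Rintegral gauss_mgf/=.
by move=> /addrI.
Qed.

End standard_normal.

(** * Characteristic function of the standard normal law, by differentiation under the integral *)

Lemma is_derive_under_integral {R : realType} {d} {Y : measurableType d}
    (mu : {measure set Y -> \bar R}) (f df : R -> Y -> R) (G : Y -> R) (a : R) :
  (forall x, mu.-integrable setT (EFin \o f x)) ->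
  (forall (x : R) (y : Y), is_derive x 1 (f ^~ y) (df x y)) ->
  (forall y, 0 <= G y) -> mu.-integrable setT (EFin \o G) ->
  (forall x y, a - 1 < x -> x < a + 1 -> `|df x y| <= G y) ->
  is_derive a 1 (fun x => \int[mu]_y f x y) (\int[mu]_y df a y).
Proof.
move=> intf derf G0 intG dfG.
have Ia : `]a - 1, a + 1[%classic a by rewrite /= in_itv/= ltrBlDr ltrDl ltr01.
have df1 x y : partial1of2 f x y = df x y.
  by rewrite partial1of2E; exact: derive_val.
have G_ub x y : `]a - 1, a + 1[%classic x -> setT y -> `|partial1of2 f x y| <= G y.
  by rewrite /= in_itv/= => /andP[? ?] _; rewrite df1; exact: dfG.
have derf1 x y : `]a - 1, a + 1[%classic x -> [set: Y] y -> derivable (f ^~ y) x 1.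
  by move=> _ _; exact: ex_derive.
have intf1 x : `]a - 1, a + 1[%classic x -> mu.-integrable setT (EFin \o f x).
  by move=> _; exact: intf.
apply: DeriveDef.
  exact: (derivable_under_integral measurableT Ia intf1 derf1 G0 intG G_ub).
rewrite -derive1E (differentiation_under_integral measurableT Ia intf1 derf1 G0 intG G_ub).
by apply: eq_Rintegral => y _; rewrite df1.
Qed.

Section gauss_char.
Context {R : realType}.
Notation gam := (normal_prob (0:R) 1).

Lemma is_derive_affine (c e x : R) : is_derive x 1 (fun t => t * c + e) c.
Proof. by apply: is_derive_eq; rewrite addr0 scaler0 add0r; exact: mulr1. Qed.

(** Dominating function for both differentiations below: it bounds [y * expR (h * y)] for all [h] in
    [-1, 1], because [|y| <= expR |y|]. *)
Let G (y : R) := expR (2 * y) + expR (- 2 * y).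

Let G_ge0 y : 0 <= G y. Proof. by rewrite addr_ge0// expR_ge0. Qed.

Let intG : gam.-integrable setT (EFin \o G).
Proof.
by apply: integrable_addr; exact: gauss_integrable_exp.
Qed.

Let expG (h y : R) : `|h| <= 1 -> `|y * expR (h * y)| <= G y.
Proof.
move=> h1; rewrite normrM [`|expR _|]ger0_norm ?expR_ge0//.
apply: (@le_trans _ _ (expR `|y| * expR `|y|)).
  apply: ler_pM => //.
    by rewrite (le_trans _ (expR_ge1Dx _))// lerDr.
  rewrite ler_expR (le_trans (ler_norm _))// normrM ler_piMl//.
rewrite -expRD /G.
have [y0|y0] := ger0P y.
  by rewrite (_ : y + y = 2 * y) ?lerDl ?expR_ge0//; ring.
by rewrite (_ : - y - y = - 2 * y) ?lerDr ?expR_ge0//; ring.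
Qed.

Lemma gauss_cos_derive (a b : R) :
  is_derive a 1 (fun t => \int[gam]_x cos (t * x + b))
    (- \int[gam]_x (x * sin (a * x + b))).
Proof.
have H : is_derive a 1 (fun t => \int[gam]_x cos (t * x + b))
    (\int[gam]_x (- sin (a * x + b) * x)).
  apply: (@is_derive_under_integral R _ _ gam (fun t x => cos (t * x + b))
    (fun t x => - sin (t * x + b) * x) G) => //.
  - by move=> x; exact: gauss_integrable_cos.
  - move=> x y; apply: (@is_derive1_comp R cos (fun t => t * y + b)).
    exact: is_derive_affine.
  - move=> x y _ _; rewrite normrM normrN.
    apply: le_trans (_ : `|y| <= _); first by rewrite ler_piMl// sin_norm_le1.
    by have := @expG 0 y; rewrite normr0 ler01 mul0r expR0 mulr1; exact.
apply: (is_derive_eq H).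
under eq_Rintegral do rewrite mulNr -mulrN mulrC -mulN1r -mulrA.
rewrite RintegralZl ?mulN1r//.
apply: (le_integrable measurableT _ _ intG).
  apply/measurable_EFinP/measurable_funM => //; exact: measurable_sin_affine.
move=> x _ /=; rewrite lee_fin normrM [leRHS]ger0_norm//.
apply: le_trans (_ : `|x| <= _); first by rewrite ler_piMr// sin_norm_le1.
by have := @expG 0 x; rewrite normr0 ler01 mul0r expR0 mulr1; exact.
Qed.

Lemma gauss_cos_exp_derive (a b : R) :
  is_derive (0:R) 1 (fun h => \int[gam]_x (cos (a * x + b) * expR (h * x)))
    (\int[gam]_x (x * cos (a * x + b))).
Proof.
have H : is_derive (0:R) 1 (fun h => \int[gam]_x (cos (a * x + b) * expR (h * x)))
    (\int[gam]_x (cos (a * x + b) * (x * expR (0 * x)))).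
  apply: (@is_derive_under_integral R _ _ gam
    (fun h x => cos (a * x + b) * expR (h * x))
    (fun h x => cos (a * x + b) * (x * expR (h * x))) G) => //.
  - by move=> h; exact: gauss_integrable_cos_exp.
  - move=> h y.
    have He : is_derive h 1 (fun t => expR (t * y)) (expR (h * y) * y).
      apply: (@is_derive1_comp R expR (fun t => t * y)).
      by have := is_derive_affine y 0 h; under eq_fun do rewrite addr0.
    rewrite [y * _]mulrC.
    exact: (@is_deriveZ _ _ _ _ (cos (a * y + b)) _ _ _ He).
  - move=> h y; rewrite sub0r add0r => h1 h2; rewrite normrM.
    apply: le_trans (expG y (_ : `|h| <= 1)); last by rewrite ler_norml !ltW.
    by rewrite ler_piMl// cos_norm_le1.
apply: (is_derive_eq H).
by apply: eq_Rintegral => x _; rewrite mul0r expR0 mulr1 mulrC.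
Qed.

Lemma gauss_cosD (a b c : R) :
  \int[gam]_x cos (a * x + (c + b)) =
  cos c * \int[gam]_x cos (a * x + b) - sin c * \int[gam]_x sin (a * x + b).
Proof.
rewrite -!RintegralZl//; last 2 first.
- exact: gauss_integrable_sin.
- exact: gauss_integrable_cos.
rewrite -RintegralB//; last 2 first.
- by apply: integrable_scaler; exact: gauss_integrable_cos.
- by apply: integrable_scaler; exact: gauss_integrable_sin.
by apply: eq_Rintegral => x _; rewrite addrCA cosD.
Qed.

(** Stein's identity E[x f(x)] = E[f'(x)] for a cosine. Both sides of [gauss_tilt_cos] are
    differentiated in the tilt [h] at 0: the left side brings down the factor [x], the right side
    shifts the phase by [a * h]. *)
Lemma gauss_cos_stein (a b : R) :
  \int[gam]_x (x * cos (a * x + b)) = - a * \int[gam]_x sin (a * x + b).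
Proof.
set C := \int[gam]_x cos (a * x + b); set S := \int[gam]_x sin (a * x + b).
have := gauss_cos_exp_derive a b.
under eq_fun do rewrite gauss_tilt_cos gauss_cosD -/C -/S.
move=> H1.
have H2 : is_derive (0:R) 1 (fun h => expR (h ^+ 2 / 2) * (cos (a * h) * C - sin (a * h) * S)) (- a * S).
  have D1 : is_derive (0:R) 1 (fun h => h ^+ 2 / 2) 0.
    by apply: is_derive_eq; rewrite /GRing.scale/=; ring.
  have D2 : is_derive (0:R) 1 (fun h => a * h) a.
    have := is_derive_affine a 0 0.
    by under eq_fun do rewrite addr0 mulrC.
  have D3 := @is_derive1_comp R expR _ 0 _ _ (is_derive_expR _) D1.
  have D4 := @is_derive1_comp R cos _ 0 _ _ (is_derive_cos _) D2.
  have D5 := @is_derive1_comp R sin _ 0 _ _ (is_derive_sin _) D2.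
  have D6 := is_deriveB (is_deriveZ C D4) (is_deriveZ S D5).
  have D7 := is_deriveM D3 D6.
  have E : (fun h => expR (h ^+ 2 / 2) * (cos (a * h) * C - sin (a * h) * S)) =
    (expR \o (fun h : R => h ^+ 2 / 2)) *
    ((C \*: (cos \o (fun h => a * h)) : R -> R) - (S \*: (sin \o (fun h => a * h)) : R -> R)).
    by apply/funext => h; rewrite !fctE /= /GRing.scale/= mulrC [C * _]mulrC [S * _]mulrC mulrC.
  rewrite E; apply: (is_derive_eq D7).
  rewrite /= !mulr0 expr0n mul0r expR0 sin0 cos0 /GRing.scale/=; ring.
by rewrite -(@derive_val _ _ _ _ _ _ _ H1) (@derive_val _ _ _ _ _ _ _ H2).
Qed.

(** By Stein's identity, phi(t) = E[cos (t x + b)] satisfies phi' = - t phi, so [expR (t ^+ 2 / 2)]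
    times phi(t) is constant, equal to its value [cos b] at 0. *)
Lemma gauss_cos (a b : R) :
  \int[gam]_x cos (a * x + b) = cos b * expR (- (a ^+ 2 / 2)).
Proof.
have stein t : \int[gam]_x (x * sin (t * x + b)) = t * \int[gam]_x cos (t * x + b).
  (* The phase shift by [pi / 2] turns the identity for the cosine into the one for the sine. *)
  have := gauss_cos_stein t (b - pi / 2).
  under eq_Rintegral do rewrite addrA cosBpihalf.
  under [X in _ = _ * X -> _]eq_Rintegral do rewrite addrA sinBpihalf -mulN1r.
  by rewrite RintegralZl ?mulN1r ?mulrNN//; exact: gauss_integrable_cos.
have D (t : R) : is_derive t 1 (fun t => expR (t ^+ 2 / 2) * \int[gam]_x cos (t * x + b)) 0.
  have D1 : is_derive t 1 (fun h => h ^+ 2 / 2) t.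
    by apply: is_derive_eq; rewrite /GRing.scale/=; field.
  have D3 := @is_derive1_comp R expR _ t _ _ (is_derive_expR _) D1.
  apply: (is_derive_eq (is_deriveM D3 (gauss_cos_derive t b))).
  by rewrite stein /= /GRing.scale/=; ring.
have := @is_derive_0_is_cst R _ a 0 D.
rewrite expr0n mul0r expR0 mul1r => H.
have -> : \int[gam]_x cos (a * x + b) =
    expR (- (a ^+ 2 / 2)) * (expR (a ^+ 2 / 2) * \int[gam]_x cos (a * x + b)).
  by rewrite mulrA -expRD addNr expR0 mul1r.
rewrite H mulrC; congr (_ * _).
under eq_Rintegral do rewrite mul0r add0r.
apply: (etrans (Rintegral_cst gam measurableT _)).
by rewrite (congr1 fine (probability_setT gam)) mulr1.
Qed.

End gauss_char.

Lemma markov_set {d} {T : measurableType d} {R : realType}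
    (P : {measure set T -> \bar R}) (f : T -> R) (c : R) (A : set T) :
  0 < c -> measurable A -> measurable_fun setT f -> (forall x, 0 <= f x) ->
  (forall x, A x -> c <= f x) ->
  (c%:E * P A <= \int[P]_x (f x)%:E)%E.
Proof.
move=> c0 mA mf f0 Af.
have mfE : measurable_fun setT (EFin \o f) by exact/measurable_EFinP.
apply: (@le_trans _ _ (\int[P]_(x in A) (f x)%:E)%E).
  rewrite -integral_cst//; apply: ge0_le_integral => //.
  - by move=> x _; rewrite lee_fin ltW.
  - exact: measurable_funTS.
by apply: (ge0_subset_integral _ mA measurableT mfE) => // x _; rewrite lee_fin.
Qed.

(** * The distribution function [Phi]: tail bounds, continuity, quantiles *)

Section Phi.
Context {R : realType}.
Notation gam := (normal_prob (0:R) 1).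

Lemma gauss_fin_num (A : set R) : measurable A -> gam A \is a fin_num.
Proof. by move=> mA; exact: (fin_num_measure gam A mA). Qed.

Lemma PhiB (x y : R) : x <= y -> Phi y - Phi x = fine (gam `]x, y]).
Proof.
move=> xy; rewrite /Phi; apply/eqP; rewrite subr_eq addrC; apply/eqP.
rewrite -fineD; [|exact: gauss_fin_num..].
congr fine; rewrite -(measureU gam)//.
  by congr (gam _); rewrite -itv_bndbnd_setU// bnd_simp.
apply/seteqP; split => // t [] /=; rewrite !in_itv/= => tx /andP[xt _].
by move: (lt_le_trans xt tx); rewrite ltxx.
Qed.

Lemma Phi_mono (x y : R) : x <= y -> Phi x <= Phi y.
Proof. by move=> xy; rewrite -subr_ge0 PhiB// fine_ge0//; exact: (measure_ge0 gam). Qed.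

Lemma PhiC (x : R) : 1 - Phi x = fine (gam `]x, +oo[).
Proof.
apply/eqP; rewrite subr_eq addrC; apply/eqP.
rewrite /Phi -fineD; [|exact: gauss_fin_num..].
rewrite -(measureU gam)//.
  rewrite -itv_bndbnd_setU//.
  by rewrite set_itvNyy (congr1 fine (probability_setT gam)).
apply/seteqP; split => // t [] /=; rewrite !in_itv/= andbT => tx xt.
by move: (lt_le_trans xt tx); rewrite ltxx.
Qed.

Lemma normal_pdf01_decr (x y : R) : 0 <= x -> x <= y ->
  normal_pdf 0 1 y <= normal_pdf 0 1 x.
Proof.
move=> x0 xy; rewrite !normal_pdfE ?oner_eq0//.
apply: ler_wpM2l; first exact: normal_peak_ge0.
rewrite ler_expR !subr0 ler_pM2r ?invr_gt0 ?mulrn_wgt0 ?exprn_gt0//.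
by rewrite lerN2 lerXn2r// nnegrE// (le_trans x0).
Qed.

(** The tail is at least the mass of []z, z + 1]], an interval of length 1 on which the density is
    smallest at the right end. *)
Lemma PhiC_lower (z : R) : 0 <= z -> normal_pdf 0 1 (z + 1) <= 1 - Phi z.
Proof.
move=> z0; rewrite PhiC -lee_fin fineK ?gauss_fin_num//.
have mpdf : measurable_fun setT (fun x : R => (normal_pdf 0 1 x)%:E).
  by apply/measurable_EFinP; exact: measurable_normal_pdf.
apply: (@le_trans _ _ (gam `]z, z + 1])); last first.
  by apply: (le_measure gam); rewrite ?inE//; exact: subset_itvl.
apply: (@le_trans _ _ (\int[lebesgue_measure]_(x in `]z, (z + 1)%R]) (normal_pdf 0 1 (z + 1))%:E)%E).
  rewrite integral_cst//= lebesgue_measure_itv/= lte_fin ltrDl ltr01.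
  by rewrite -EFinD addrAC subrr add0r mule1.
apply: ge0_le_integral => //.
- by move=> x _; rewrite lee_fin normal_pdf_ge0.
- exact: measurable_funTS.
- move=> x /=; rewrite in_itv/= lee_fin => /andP[zx xz].
  by apply: normal_pdf01_decr => //; rewrite (le_trans z0)// ltW.
Qed.

Lemma Phi_lt1 (z : R) : Phi z < 1.
Proof.
rewrite -subr_gt0.
apply: (@lt_le_trans _ _ (1 - Phi (Num.max z 0))); last first.
  by rewrite lerD2l lerN2 Phi_mono// le_max lexx.
apply: (@lt_le_trans _ _ (normal_pdf 0 1 (Num.max z 0 + 1))).
  by rewrite normal_pdfE ?oner_eq0// mulr_gt0 ?expR_gt0// normal_peak_gt0 ?oner_eq0.
by apply: PhiC_lower; rewrite le_max lexx orbT.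
Qed.

Lemma Phi_lipschitz (x y : R) : x <= y ->
  Phi y - Phi x <= normal_peak 1 * (y - x).
Proof.
move=> xy; rewrite PhiB// -lee_fin fineK ?gauss_fin_num//.
apply: (@le_trans _ _ (\int[lebesgue_measure]_(x in `]x, y]) (normal_peak 1)%:E)%E).
  apply: ge0_le_integral => //.
  - by move=> t _; rewrite lee_fin normal_pdf_ge0.
  - by apply: measurable_funTS; apply/measurable_EFinP; exact: measurable_normal_pdf.
  - by move=> t _; rewrite lee_fin normal_pdf_ub// oner_eq0.
rewrite integral_cst//= lebesgue_measure_itv/= lte_fin.
case: ltP => xy'; first by rewrite -EFinD -EFinM lexx.
by rewrite mule0 lee_fin mulr_ge0 ?normal_peak_ge0// subr_ge0.
Qed.

Lemma Phi_continuous : continuous (@Phi R).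
Proof.
move=> x; apply/cvgrPdist_le => e e0; near=> y.
have H (u v : R) : u <= v -> `|Phi u - Phi v| <= normal_peak 1 * `|u - v|.
  move=> uv; rewrite distrC ger0_norm ?subr_ge0 ?Phi_mono//.
  by rewrite distrC [`|v - u|]ger0_norm ?subr_ge0// Phi_lipschitz.
have {}H : `|Phi x - Phi y| <= normal_peak 1 * `|x - y|.
  have [xy|/ltW yx] := leP x y; first exact: H.
  by rewrite distrC [`|x - y|]distrC H.
apply: (le_trans H); rewrite -ler_pdivlMl ?normal_peak_gt0 ?oner_eq0//.
near: y; apply: cvgr_dist_le; first exact: cvg_id.
by rewrite mulr_gt0// invr_gt0 normal_peak_gt0 ?oner_eq0.
Unshelve. all: by end_near. Qed.

(** Chernoff's bound with parameter 1: crude, but it serves only to show that [Phi] tends to 1 when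
    quantiles are constructed. *)
Lemma PhiC_upper (z : R) : 1 - Phi z <= expR (1 / 2 - z).
Proof.
rewrite PhiC -lee_fin fineK ?gauss_fin_num// expRD expRN [X in (_ <= X%:E)%E]mulrC EFinM.
rewrite lee_pdivlMl ?expR_gt0//.
have H (x : R) : `]z, +oo[%classic x -> expR z <= expR (1 * x).
  by rewrite /= in_itv/= andbT ler_expR mul1r => /ltW.
apply: le_trans (@markov_set _ _ _ gam _ _ _ (expR_gt0 z)
  (measurable_itv _) (measurable_exp_scale 1) (fun x => expR_ge0 _) H) _.
by rewrite gauss_mgf expr1n.
Qed.

Lemma Phi_upper (z : R) : Phi z <= expR (1 / 2 + z).
Proof.
rewrite -lee_fin fineK ?gauss_fin_num// expRD -[z in leRHS]opprK expRN [X in (_ <= X%:E)%E]mulrC EFinM.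
rewrite lee_pdivlMl ?expR_gt0//.
have H (x : R) : `]-oo, z]%classic x -> expR (- z) <= expR (- 1 * x).
  by rewrite /= in_itv/= ler_expR mulN1r lerN2.
apply: le_trans (@markov_set _ _ _ gam _ _ _ (expR_gt0 (- z))
  (measurable_itv _) (measurable_exp_scale (- 1)) (fun x => expR_ge0 _) H) _.
by rewrite gauss_mgf sqrrN expr1n.
Qed.

(** The exponential tail bounds give points where [Phi] is below and above [q]; the intermediate
    value theorem does the rest. *)
Lemma Phi_quantile (q : R) : 0 < q -> q < 1 -> exists z, Phi z = q.
Proof.
move=> q0 q1.
have ex (e : R) : 0 < e -> exists2 M, 0 < M & expR (1 / 2 - M) <= e.
  move=> e0; exists (`|1 / 2 - ln e| + 1); first by rewrite ltr_wpDl.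
  rewrite -[leRHS]lnK ?posrE// ler_expR lerBlDl -lerBlDr.
  by rewrite (le_trans (ler_norm _))// lerDl.
have [M M0 eM] := ex _ q0.
have [N N0 eN] : exists2 M, 0 < M & expR (1 / 2 - M) <= 1 - q by apply: ex; rewrite subr_gt0.
have MN : - M <= N by rewrite (@le_trans _ _ 0)// ?oppr_le0 ltW.
have lo : Phi (- M) <= q by rewrite (le_trans (Phi_upper _)).
have hi : q <= Phi N.
  by rewrite -[leRHS](subKr 1) lerBrDl addrC -lerBrDl (le_trans (PhiC_upper _)).
have [|z _ <-] := IVT MN (continuous_subspaceT Phi_continuous) (v := q); last by exists z.
by rewrite minEle maxEle (Phi_mono MN) lo.
Qed.

End Phi.

(** * Linear combinations of equicorrelated normal variables *)

(** Representing the law as that of [m + s * x], with [x] standard normal, covers the point mass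
    [s = 0] and the nondegenerate case by one formula. *)
Lemma normal_law_integral_ge0 {d} {T : measurableType d} {R : realType}
    (P : probability T R) (Y : T -> R) (m s : R) (f : R -> R) :
  measurable_fun setT Y -> 0 <= s -> has_normal_law P Y m s ->
  continuous f -> (forall x, 0 <= f x) ->
  (\int[P]_w (f (Y w))%:E = \int[normal_prob 0 1]_x (f (m + s * x))%:E)%E.
Proof.
move=> mY s0 lawY cf f0.
have mf : measurable_fun [set: measurableTypeR R] (EFin \o f).
  by apply/measurable_EFinP; exact: continuous_measurable_fun.
have mY' : measurable_fun setT (Y : T -> measurableTypeR R) := mY.
have := @ge0_integral_pushforward _ _ _ _ _ _ mY' P setT (EFin \o f) measurableT mf.
rewrite preimage_setT => <-; last by move=> x _; rewrite /= lee_fin.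
move: lawY; rewrite /has_normal_law /normal_law; case: eqVneq => [->|sn0] lawY.
  transitivity (\int[\d_(m : measurableTypeR R)]_y (f y)%:E)%E.
    by apply: (eq_measure_integral \d_(m : measurableTypeR R)) => A mA _; exact: (lawY A mA).
  rewrite integral_dirac// diracT mul1e/=.
  under eq_integral do rewrite mul0r addr0.
  rewrite (integral_cst (normal_prob (0:R) 1) measurableT (f m)%:E).
  by rewrite [X in (_ * X)%E](probability_setT (normal_prob (0:R) 1)) mule1.
transitivity (\int[normal_prob m s]_y (f y)%:E)%E.
  by apply: (eq_measure_integral (normal_prob m s)) => A mA _; exact: (lawY A mA).
by apply: normal_prob_subst => //; rewrite lt0r sn0.
Qed.

Lemma normal_law_integral {d} {T : measurableType d} {R : realType}
    (P : probability T R) (Y : T -> R) (m s : R) (f : R -> R) :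
  measurable_fun setT Y -> 0 <= s -> has_normal_law P Y m s -> continuous f ->
  (\int[P]_w (f (Y w))%:E = \int[normal_prob 0 1]_x (f (m + s * x))%:E)%E.
Proof.
move=> mY s0 lawY cf.
rewrite integralE [RHS]integralE.
have cmax (g : R -> R) : continuous g -> continuous (fun x => Num.max (g x) 0).
  by move=> cg x; apply: continuous_max; [exact: cg|exact: cvg_cst].
have H (g : R -> R) : continuous g ->
    (\int[P]_w (Num.max (g (Y w)) 0)%:E =
     \int[normal_prob 0 1]_x (Num.max (g (m + s * x)) 0)%:E)%E.
  move=> cg; apply: (normal_law_integral_ge0 mY s0 lawY (cmax _ cg)).
  by move=> x; rewrite le_max lexx orbT.
have cN : continuous (fun x => - f x) by move=> x; apply: cvgN; exact: cf.
congr (_ - _)%E.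
  rewrite (funerpos (f \o Y)) (funerpos (fun x => f (m + s * x))).
  exact: (H _ cf).
rewrite (funerneg (f \o Y)) (funerneg (fun x => f (m + s * x))).
exact: (H _ cN).
Qed.

Lemma normal_law_integrable {d} {T : measurableType d} {R : realType}
    (P : probability T R) (Y : T -> R) (m s : R) (f : R -> R) :
  measurable_fun setT Y -> 0 <= s -> has_normal_law P Y m s -> continuous f ->
  (normal_prob (0:R) 1).-integrable setT (EFin \o (fun x => f (m + s * x))) ->
  P.-integrable setT (EFin \o (f \o Y)).
Proof.
move=> mY s0 lawY cf /integrableP[_ fi]; apply/integrableP; split.
  apply/measurable_EFinP; apply: measurableT_comp => //.
  exact: continuous_measurable_fun.
have cn : continuous (fun x => `|f x|).
  by move=> x; apply: (@continuous_comp _ _ _ f Num.norm); [exact: cf|exact: norm_continuous].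
have := normal_law_integral mY s0 lawY cn.
by rewrite /comp/= => ->.
Qed.

Lemma Rintegral_sum {d} {T : measurableType d} {R : realType}
    (mu : {measure set T -> \bar R}) (I : Type) (r : seq I) (f : I -> T -> R) :
  (forall i, mu.-integrable setT (EFin \o f i)) ->
  mu.-integrable setT (EFin \o (fun w => \sum_(i <- r) f i w)) /\
  \int[mu]_w (\sum_(i <- r) f i w) = \sum_(i <- r) \int[mu]_w f i w.
Proof.
move=> fi; elim: r => [|i r [ih1 ih2]].
  split; first by under eq_fun do rewrite big_nil; exact: integrable0.
  by under eq_Rintegral do rewrite big_nil; rewrite big_nil /Rintegral integral0.
split; first by under eq_fun do rewrite big_cons; exact: integrable_addr.
under eq_Rintegral do rewrite big_cons.
by rewrite RintegralD// ih2 big_cons.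
Qed.

(** * First and second moments of the standard normal law *)

Section gauss_moments.
Context {R : realType}.
Notation gam := (normal_prob (0:R) 1).

Lemma sqr_le_expR (x : R) : x ^+ 2 <= expR (2 * x) + expR (- 2 * x).
Proof.
have H : `|x| <= expR `|x| by rewrite (le_trans _ (expR_ge1Dx _))// lerDr.
apply: (@le_trans _ _ (expR `|x| * expR `|x|)).
  by rewrite -real_normK ?num_real// expr2 ler_pM.
rewrite -expRD; have [x0|x0] := ger0P x.
  by rewrite (_ : x + x = 2 * x) ?lerDl ?expR_ge0//; ring.
by rewrite (_ : - x - x = - 2 * x) ?lerDr ?expR_ge0//; ring.
Qed.

Lemma gauss_integrable_sqr : gam.-integrable setT (EFin \o (fun x => x ^+ 2)).
Proof.
have h : gam.-integrable setT (EFin \o (fun x => expR (2 * x) + expR (- 2 * x))).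
  by apply: integrable_addr; exact: gauss_integrable_exp.
apply: (le_integrable measurableT _ _ h).
  by apply/measurable_EFinP; exact: measurable_funX.
move=> x _ /=; rewrite lee_fin ger0_norm ?sqr_ge0//.
by rewrite (le_trans (sqr_le_expR x))// ler_norm.
Qed.

Lemma gauss_integrable_id : gam.-integrable setT (EFin \o (fun x => x)).
Proof.
have h : gam.-integrable setT (EFin \o (fun x => 1 + x ^+ 2)).
  by apply: integrable_addr; [exact: finite_measure_integrable_cst|exact: gauss_integrable_sqr].
apply: (le_integrable measurableT _ _ h) => //.
  exact/measurable_EFinP.
move=> x _ /=; rewrite lee_fin [leRHS]ger0_norm ?addr_ge0 ?sqr_ge0//.
rewrite -[x ^+ 2]real_normK ?num_real//.
have := sqr_ge0 (`|x| - 1 / 2); nra.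
Qed.

Lemma gauss_mean : \int[gam]_x x = 0.
Proof.
have := @gauss_cos_stein R 0 0; rewrite oppr0 mul0r => h.
rewrite -[RHS]h.
by apply: eq_Rintegral => x _; rewrite mul0r addr0 cos0 mulr1.
Qed.

(** The second moment enters as a common factor of all covariances and is cancelled, so positivity
    suffices and its value is never computed. *)
Lemma gauss_sqr_gt0 : 0 < \int[gam]_x (x ^+ 2).
Proof.
apply: (@lt_le_trans _ _ (1 - Phi 1)); first by rewrite subr_gt0 Phi_lt1.
rewrite PhiC -lee_fin fineK ?gauss_fin_num// fineK; last first.
  exact: (integrable_fin_num measurableT gauss_integrable_sqr).
have H (x : R) : `]1, +oo[%classic x -> 1 <= x ^+ 2.
  by rewrite /= in_itv/= andbT => x1; rewrite exprn_ege1// ltW.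
have m2 : measurable_fun setT (fun x : R => x ^+ 2) by exact: measurable_funX.
have := @markov_set _ _ _ gam _ _ _ ltr01 (measurable_itv _) m2 (fun x => sqr_ge0 _) H.
by rewrite mul1e.
Qed.

End gauss_moments.

(** The variance of [\sum_i a i * X i] when all variances are 1 and all correlations are [rho]. *)
Definition equicorr_form {R : realType} (rho : R) {n : nat} (a : 'I_n -> R) : R :=
  (1 - rho) * (\sum_i a i ^+ 2) + rho * (\sum_i a i) ^+ 2.

Section equicorrelated.
Context {d : measure_display} {Om : measurableType d} {R : realType}.
Variables (P : probability Om R) (n : nat) (X : 'I_n -> {RV P >-> R}).
Variables (mu : 'I_n -> R) (rho : R).
Hypothesis eqX : equicorrelated_normal P X mu rho.
Hypothesis mu0 : global_null mu.
Notation gam := (normal_prob (0:R) 1).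
Let e2 := \int[gam]_x (x ^+ 2).

Let mX i : measurable_fun setT (X i : Om -> R).
Proof. exact: measurable_funPT. Qed.

Let lawX i : has_normal_law P (X i) 0 1.
Proof. by case: eqX => _ /(_ i) + _; rewrite mu0. Qed.

Let integrable_X i : P.-integrable setT (EFin \o X i).
Proof.
apply: (normal_law_integrable (mX i) ler01 (lawX i) (f := fun x => x)).
  by move=> x; exact: cvg_id.
by under eq_fun do rewrite add0r mul1r; exact: gauss_integrable_id.
Qed.

Let integrable_X2 i : P.-integrable setT (EFin \o (fun w => X i w ^+ 2)).
Proof.
apply: (normal_law_integrable (mX i) ler01 (lawX i) (f := fun x => x ^+ 2)).
  exact: exprn_continuous.
by under eq_fun do rewrite add0r mul1r; exact: gauss_integrable_sqr.
Qed.

Let integrable_XX i j : P.-integrable setT (EFin \o (fun w => X i w * X j w)).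
Proof.
apply: (le_integrable measurableT _ _ (integrable_addr (integrable_X2 i) (integrable_X2 j))).
  by apply/measurable_EFinP; exact: measurable_funM.
move=> w _ /=; rewrite lee_fin [leRHS]ger0_norm ?addr_ge0 ?sqr_ge0// normrM.
rewrite -[X i w ^+ 2]real_normK ?num_real// -[X j w ^+ 2]real_normK ?num_real//.
have := sqr_ge0 (`|X i w| - `|X j w|).
have := normr_ge0 (X i w); have := normr_ge0 (X j w); nra.
Qed.

Let mean_X i : \int[P]_w X i w = 0.
Proof.
rewrite /Rintegral (normal_law_integral (mX i) ler01 (lawX i) (f := fun x => x)).
  under eq_integral do rewrite add0r mul1r.
  exact: gauss_mean.
by move=> x; exact: cvg_id.
Qed.

Let moment_XX i j : \int[P]_w (X i w * X j w) = (if i == j then 1 else rho) * e2.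
Proof.
have sqrX k : \int[P]_w (X k w * X k w) = e2.
  rewrite /Rintegral (normal_law_integral (mX k) ler01 (lawX k) (f := fun x => x * x)).
    by under eq_integral do rewrite add0r mul1r -expr2.
  by move=> x; apply: cvgM; exact: cvg_id.
case: eqVneq => [->|ij]; first by rewrite mul1r sqrX.
have L1 k : (X k : Om -> R) \in Lfun P 1 by apply/Lfun1_integrable; exact: integrable_X.
have E0 k : ('E_P[X k] = 0)%E.
  rewrite expectation_def; have := mean_X k; rewrite /Rintegral => h.
  by rewrite -[LHS]fineK ?h//; exact: (integrable_fin_num measurableT (integrable_X k)).
have cov k l : fine (covariance P (X k) (X l)) = \int[P]_w (X k w * X l w).
  rewrite covarianceE//; last by apply/Lfun1_integrable; exact: integrable_XX.
  by rewrite !E0 mule0 sube0 unlock.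
case: eqX => _ _ /(_ _ _ ij); rewrite /correlation /variance !cov !sqrX.
rewrite -expr2 sqrtr_sqr ger0_norm; last by rewrite ltW// gauss_sqr_gt0.
by move=> <-; rewrite divfK// gt_eqF// gauss_sqr_gt0.
Qed.

Lemma lincomb_measurable (a : 'I_n -> R) :
  measurable_fun setT (fun w => \sum_(i < n) a i * X i w).
Proof. by apply: measurable_sum => i; exact: measurable_funM. Qed.

(** Joint normality provides some mean and standard deviation; the first two moments, expanded over
    coordinates and pairs of coordinates, identify them. *)
Lemma lincomb_law (a : 'I_n -> R) : exists s : R,
  [/\ 0 <= s, s ^+ 2 = equicorr_form rho a &
      has_normal_law P (fun w => \sum_(i < n) a i * X i w) 0 s].
Proof.
have mY := lincomb_measurable a.
case: eqX => /(_ a) [m [s [s0 law]]] _ _.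
have m0 : m = 0.
  have [_] := Rintegral_sum (index_enum 'I_n) (fun i => integrable_scaler (a i) (integrable_X i)).
  rewrite big1; last first.
    move=> i _; apply: (etrans (RintegralZl _ measurableT (integrable_X i))).
    by rewrite mean_X mulr0.
  rewrite /Rintegral (normal_law_integral mY s0 law (f := fun x => x)); last first.
    by move=> x; exact: cvg_id.
  rewrite -/(Rintegral _ _ _) RintegralD//; last 2 first.
  - exact: finite_measure_integrable_cst.
  - by apply: integrable_scaler; exact: gauss_integrable_id.
  rewrite RintegralZl//; last exact: gauss_integrable_id.
  rewrite gauss_mean mulr0 addr0.
  rewrite (Rintegral_cst gam measurableT).
  by rewrite (congr1 fine (probability_setT gam)) mulr1.
subst m; exists s; split => //.
have [i1 E] := Rintegral_sum (index_enum ('I_n * 'I_n)%type)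
  (fun ij => integrable_scaler (a ij.1 * a ij.2) (integrable_XX ij.1 ij.2)).
have := normal_law_integral mY s0 law (@exprn_continuous R 2).
move=> /(congr1 fine); rewrite -/(Rintegral _ _ _).
have sq w : (\sum_(i < n) a i * X i w) ^+ 2 =
    \sum_(ij : 'I_n * 'I_n) (a ij.1 * a ij.2 * (X ij.1 w * X ij.2 w)).
  rewrite expr2 big_distrlr/= pair_big/=; apply: eq_bigr => ij _.
  by rewrite mulrACA.
under eq_Rintegral do rewrite sq.
rewrite E.
under eq_integral do rewrite add0r exprMn.
rewrite -/(Rintegral _ _ _) RintegralZl//; last exact: gauss_integrable_sqr.
rewrite -/e2.
have -> : \sum_(ij : 'I_n * 'I_n) \int[P]_w (a ij.1 * a ij.2 * (X ij.1 w * X ij.2 w)) =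
   equicorr_form rho a * e2.
  transitivity (\sum_(ij : 'I_n * 'I_n) (a ij.1 * a ij.2 * (if ij.1 == ij.2 then 1 else rho)) * e2).
    apply: eq_bigr => ij _.
    by rewrite RintegralZl// moment_XX mulrA.
  rewrite -mulr_suml -(pair_big xpredT xpredT (fun i j => a i * a j * (if i == j then 1 else rho)))/=.
  congr (_ * _); rewrite /equicorr_form.
  rewrite expr2 big_distrlr/= mulr_sumr [X in _ + X]mulr_sumr -big_split/=.
  apply: eq_bigr => i _; rewrite (bigD1 i)//= eqxx mulr1 [X in _ + rho * X](bigD1 i)//=.
  rewrite mulrDr addrA mulr_sumr; congr (_ + _); first by rewrite expr2; ring.
  by apply: eq_bigr => j ji; rewrite eq_sym (negbTE ji) mulrC.
by move=> /mulIf -> //; rewrite gt_eqF// gauss_sqr_gt0.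
Qed.

Lemma lincomb_mgf (a : 'I_n -> R) :
  (\int[P]_w (expR (\sum_(i < n) a i * X i w))%:E =
   (expR (equicorr_form rho a / 2))%:E)%E.
Proof.
have [s [s0 <- law]] := lincomb_law a.
rewrite (normal_law_integral (lincomb_measurable a) s0 law (@continuous_expR R)).
under eq_integral do rewrite add0r.
by rewrite gauss_mgf.
Qed.

Lemma lincomb_cos (a : 'I_n -> R) (b : R) :
  \int[P]_w cos (\sum_(i < n) a i * X i w + b) =
  cos b * expR (- (equicorr_form rho a / 2)).
Proof.
have [s [s0 <- law]] := lincomb_law a.
have cf : continuous (fun x : R => cos (x + b)).
  move=> x; apply: (@continuous_comp _ _ _ (fun x => x + b) cos); last exact: continuous_cos.
  by apply: cvgD; [exact: cvg_id|exact: cvg_cst].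
rewrite /Rintegral (normal_law_integral (lincomb_measurable a) s0 law cf).
under eq_integral do rewrite add0r.
by rewrite -/(Rintegral _ _ _) gauss_cos.
Qed.

End equicorrelated.

(** * Independence in the uncorrelated case *)

Lemma cvg_norm_le {R : realType} (u : nat -> R) (l M : R) :
  (forall m, `|u m| <= M) -> u m @[m --> \oo] --> l -> `|l| <= M.
Proof.
move=> uM ul; have cn : `|u m| @[m --> \oo] --> `|l| by exact: cvg_norm.
rewrite -(cvg_lim (@Rhausdorff R) cn); apply: limr_le; last exact: nearW.
by apply/cvg_ex; exists `|l|.
Qed.

Lemma bounded_cvg_integral {d} {T : measurableType d} {R : realType}
    (P : probability T R) (f : nat -> T -> R) (g : T -> R) (M : R) :
  (forall m, measurable_fun setT (f m)) -> (forall m x, `|f m x| <= M) ->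
  (forall x, f m x @[m --> \oo] --> g x) ->
  \int[P]_w f m w @[m --> \oo] --> \int[P]_w g w.
Proof.
move=> mf fM fg.
have mg : measurable_fun setT g by apply: (measurable_fun_cvg mf) => x _; exact: fg.
have gM x : `|g x| <= M by apply: cvg_norm_le (fg x).
have [|||||_ _ H] := @dominated_convergence _ _ _ P setT measurableT
  (fun m w => (f m w)%:E) (fun w => (g w)%:E) (fun=> M%:E).
- by move=> m; apply/measurable_EFinP.
- exact/measurable_EFinP.
- by apply: aeW => x _; apply: cvg_EFin; [exact: nearW|exact: fg].
- exact: finite_measure_integrable_cst.
- by apply: aeW => x m _; rewrite lee_fin.
apply: fine_cvg; rewrite fineK//.
by apply: (integrable_fin_num measurableT); exact: bounded_integrable mg gM.
Qed.

(** * Functions obtained from cosines by linear combinations and bounded limits *)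

(** An inductive predicate, so that an identity stable under sums, multiples and bounded pointwise
    limits need only be checked on cosines. The bound [M] is uniform along the sequence, as
    dominated convergence requires. *)
Inductive trig_closure {R : realType} : (R -> R) -> Prop :=
| trig_cos a b : trig_closure (fun x => cos (a * x + b))
| trig_add f g : trig_closure f -> trig_closure g -> trig_closure (fun x => f x + g x)
| trig_scale k f : trig_closure f -> trig_closure (fun x => k * f x)
| trig_lim (f : nat -> R -> R) g M : (forall m, trig_closure (f m)) ->
    (forall m x, `|f m x| <= M) -> (forall x, f m x @[m --> \oo] --> g x) ->
    trig_closure g.

Section trig_closure.
Context {R : realType}.
Implicit Types f g : R -> R.

Lemma trig_measurable f : trig_closure f -> measurable_fun setT f.
Proof.
elim=> [a b|f' g _ mf _ mg|k f' _ mf|f' g M _ mf _ fg].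
- exact: measurable_cos_affine.
- exact: measurable_funD.
- exact: measurable_funM.
- by apply: (measurable_fun_cvg mf) => x _; exact: fg.
Qed.

Lemma trig_bounded f : trig_closure f -> exists M, forall x, `|f x| <= M.
Proof.
elim=> [a b|f' g _ [M fM] _ [N gN]|k f' _ [M fM]|f' g M _ _ fM fg].
- by exists 1 => x; exact: cos_norm_le1.
- by exists (M + N) => x; rewrite (le_trans (ler_normD _ _))// lerD.
- by exists (`|k| * M) => x; rewrite normrM ler_wpM2l.
- by exists M => x; apply: cvg_norm_le (fg x).
Qed.

Lemma trig_ext f g : trig_closure f -> f =1 g -> trig_closure g.
Proof. by move=> tf /funext <-. Qed.

Lemma trig_cst k : trig_closure (fun=> k : R).
Proof.
apply: trig_ext (trig_scale k (trig_cos 0 0)) _ => x.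
by rewrite mul0r addr0 cos0 mulr1.
Qed.

(** Induction on the first factor and, when that is a cosine, on the second; two cosines are handled
    by the product-to-sum formula. In the limit cases the other factor is bounded, which keeps the
    sequence uniformly bounded. *)
Lemma trig_mul f g : trig_closure f -> trig_closure g ->
  trig_closure (fun x => f x * g x).
Proof.
move=> tf tg; elim: tf => [a b|f1 f2 _ h1 _ h2|k f1 _ h1|f' h M _ th fM fh].
- elim: tg => [a' b'|g1 g2 _ h1 _ h2|k g1 _ h1|g' h M _ th gM gh].
  + apply: trig_ext (trig_scale (1/2) (trig_add (trig_cos (a + a') (b + b')) (trig_cos (a - a') (b - b')))) _ => x.
    rewrite (_ : (a + a') * x + _ = (a * x + b) + (a' * x + b')); last by ring.
    rewrite (_ : (a - a') * x + _ = (a * x + b) - (a' * x + b')); last by ring.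
    by rewrite cosD cosB; field.
  + by apply: trig_ext (trig_add h1 h2) _ => x; rewrite mulrDr.
  + by apply: trig_ext (trig_scale k h1) _ => x; rewrite mulrCA.
  + apply: (trig_lim (M := M) th) => [m x|x].
      by rewrite normrM (le_trans _ (gM m x))// ler_piMl// cos_norm_le1.
    by apply: cvgM; [exact: cvg_cst|exact: gh].
- by apply: trig_ext (trig_add h1 h2) _ => x; rewrite mulrDl.
- by apply: trig_ext (trig_scale k h1) _ => x; rewrite mulrA.
- have [N gN] := trig_bounded tg.
  apply: (trig_lim (M := M * N) th) => [m x|x].
    by rewrite normrM ler_pM.
  by apply: cvgM; [exact: fh|exact: cvg_cst].
Qed.

(* The iterates of [t |-> (3 t - t ^ 3) / 2] converge to the sign function on [[-1, 1]]. *)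
Let q (t : R) := (3 * t - t ^+ 3) / 2.

Let q_norm t : `|t| <= 1 -> `|q t| <= 1.
Proof.
rewrite !ler_norml => /andP[h1 h2]; rewrite /q.
have e1 : 0 <= (1 - t) ^+ 2 * (t + 2).
  by rewrite mulr_ge0 ?sqr_ge0//; lra.
have e2 : 0 <= (1 + t) ^+ 2 * (2 - t).
  by rewrite mulr_ge0 ?sqr_ge0//; lra.
have E1 : (1 - t) ^+ 2 * (t + 2) = 2 - (3 * t - t ^+ 3) by ring.
have E2 : (1 + t) ^+ 2 * (2 - t) = 2 + (3 * t - t ^+ 3) by ring.
rewrite E1 in e1; rewrite E2 in e2; apply/andP; split; lra.
Qed.

Let iter_norm m t : `|t| <= 1 -> `|iter m q t| <= 1.
Proof. by move=> t1; elim: m => //= m; exact: q_norm. Qed.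

Let iterN m t : iter m q (- t) = - iter m q t.
Proof. by elim: m => //= m ->; rewrite /q; field. Qed.

(** [1 - q u] is [1 - u] times [(1 - u) * (u + 2) / 2], and that factor is at most [1 - t / 2] when
    [t <= u <= 1]. The iterates never drop below [t], so they approach 1 geometrically. *)
Let iter_pos_cvg (t : R) : 0 < t -> t <= 1 -> iter m q t @[m --> \oo] --> (1 : R).
Proof.
move=> t0 t1.
have H m : t <= iter m q t <= 1 /\ 1 - iter m q t <= (1 - t / 2) ^+ m.
  elim: m => [|m [/andP[h1 h2] h3]] /=; first by rewrite lexx t1 expr0; split=> //; lra.
  set u := iter m q t in h1 h2 h3 *.
  have u0 : 0 < u by exact: lt_le_trans h1.
  have E : 1 - q u = (1 - u) * ((1 - u) * (u + 2) / 2) by rewrite /q; field.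
  have hq : 0 <= 1 - q u.
    by rewrite E !mulr_ge0//; lra.
  have hu : u <= q u.
    have : 0 <= u * ((1 - u) * (1 + u)) by rewrite !mulr_ge0//; lra.
    rewrite (_ : u * _ = u - u ^+ 3); last by ring.
    rewrite /q; lra.
  split; first by apply/andP; split; lra.
  rewrite E exprSr; apply: ler_pM => //; first lra.
    by rewrite !mulr_ge0//; lra.
  have : 0 <= u * u by rewrite mulr_ge0// ltW.
  nra.
have cv : 1 - (1 - t / 2) ^+ m @[m --> \oo] --> (1 : R).
  rewrite -[X in _ --> X]subr0; apply: cvgB; first exact: cvg_cst.
  by apply: cvg_expr; rewrite ger0_norm; lra.
apply: (@squeeze_cvgr _ _ _ _ _ (fun=> 1) _ _ _ cv); last exact: cvg_cst.
apply: nearW => m.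
by have [/andP[_ ->] h] := H m; rewrite andbT lerBlDl -lerBlDr.
Qed.

Let iter_cvg t : `|t| <= 1 -> iter m q t @[m --> \oo] --> (Num.sg t : R).
Proof.
rewrite ler_norml => /andP[h1 h2]; have [t0|t0|->] := ltrgt0P t.
- by rewrite gtr0_sg//; exact: iter_pos_cvg.
- rewrite ltr0_sg// -[t]opprK.
  under eq_fun do rewrite iterN.
  apply: cvgN; apply: iter_pos_cvg; lra.
- rewrite sgr0 (_ : (fun m => _) = cst 0); first exact: cvg_cst.
  by apply/funext => m; elim: m => //= m ->; rewrite /q /= mulr0 expr0n subr0 mul0r.
Qed.

Let trig_q f : trig_closure f -> trig_closure (fun x => q (f x)).
Proof.
move=> tf.
apply: trig_ext (trig_add (trig_scale (3 / 2) tf)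
  (trig_scale (- 1 / 2) (trig_mul tf (trig_mul tf tf)))) _ => x.
by rewrite /q; field.
Qed.

(** Iterating [q] on the sine [t k], which takes values in [-1, 1], gives its sign. Once
    [k.+1 > |x - z|], the argument [(x - z) / k.+1] lies strictly between [- pi] and [pi], where the
    sine has the sign of its argument; hence the signs are eventually constant in [k]. *)
Lemma trig_sg (z : R) : trig_closure (fun x => Num.sg (x - z)).
Proof.
pose t (k : nat) (x : R) := sin (k.+1%:R^-1 * x + - z / k.+1%:R).
have tt k : trig_closure (t k).
  apply: trig_ext (trig_cos (k.+1%:R^-1) (- z / k.+1%:R - pi / 2)) _ => x.
  by rewrite addrA cosBpihalf.
have ts k : trig_closure (fun x => Num.sg (t k x)).
  apply: (trig_lim (f := fun m x => iter m q (t k x)) (M := 1)).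
  - by elim=> //= m; exact: trig_q.
  - by move=> m x; apply: iter_norm; exact: sin_norm_le1.
  - by move=> x; apply: iter_cvg; exact: sin_norm_le1.
apply: (trig_lim (f := fun k x => Num.sg (t k x)) (M := 1) ts).
  by move=> m x; rewrite normr_sg; case: eqP => //; rewrite ?lexx ?ler01.
move=> x; apply: cvg_near_cst; near=> k.
have k0 : 0 < k.+1%:R :> R by rewrite ltr0n.
have -> : t k x = sin ((x - z) / k.+1%:R).
  by rewrite /t; congr sin; rewrite mulrDl mulrC mulNr.
have hk : `|x - z| < k.+1%:R.
  apply: (@lt_le_trans _ _ k%:R); last by rewrite ler_nat.
  by near: k; exact: nbhs_infty_gtr.
have [y0|y0|->] := ltrgt0P (x - z).
- rewrite !gtr0_sg// sin_gt0_pi// divr_gt0//=.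
  rewrite (@lt_le_trans _ _ 1) ?ltr_pdivrMr ?mul1r//; last by rewrite (le_trans _ (pi_ge2 R))// ler1n.
  by rewrite gtr0_norm in hk.
- rewrite -[X in sin (X / _)]opprK mulNr sinN !ltr0_sg// oppr_lt0 sin_gt0_pi//.
  rewrite divr_gt0 ?oppr_gt0//=.
  rewrite (@lt_le_trans _ _ 1) ?ltr_pdivrMr ?mul1r//; last by rewrite (le_trans _ (pi_ge2 R))// ler1n.
  by rewrite ltr0_norm in hk.
- by rewrite mul0r sin0.
Unshelve. all: by end_near. Qed.

(** With s the sign of [x - z], the indicator is 1 - (s + s^2) / 2, also at s = 0. *)
Lemma trig_itv (z : R) : trig_closure (fun x : R => ((x <= z)%R : nat)%:R).
Proof.
have ts := trig_sg z.
apply: trig_ext (trig_add (trig_cst 1)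
  (trig_scale (- 1 / 2) (trig_add ts (trig_mul ts ts)))) _ => x /=.
rewrite -[x <= z]subr_le0; have [y0|y0|->] := ltrgt0P (x - z).
- by rewrite gtr0_sg//=; field.
- by rewrite ltr0_sg//=; field.
- by rewrite sgr0/=; ring.
Qed.

End trig_closure.

Definition bounded_measurable {d} {T : measurableType d} {R : realType} (f : T -> R) :=
  measurable_fun setT f /\ exists M, forall x, `|f x| <= M.

Section bounded_measurable.
Context {d : measure_display} {T : measurableType d} {R : realType}.
Implicit Types f g : T -> R.

Lemma bounded_measurableM f g : bounded_measurable f -> bounded_measurable g ->
  bounded_measurable (fun x => f x * g x).
Proof.
move=> [mf [M fM]] [mg [N gN]]; split; first exact: measurable_funM.
by exists (M * N) => x; rewrite normrM ler_pM.
Qed.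

Lemma bounded_measurable_prod (I : eqType) (s : seq I) (f : I -> T -> R) :
  (forall i, bounded_measurable (f i)) ->
  bounded_measurable (fun x => \prod_(i <- s) f i x).
Proof.
move=> bf; elim: s => [|i s ih].
  by under eq_fun do rewrite big_nil; split => //; exists 1 => x; rewrite normr1.
by under eq_fun do rewrite big_cons; exact: bounded_measurableM.
Qed.

Lemma bounded_measurable_integrable (P : probability T R) f :
  bounded_measurable f -> P.-integrable setT (EFin \o f).
Proof. by move=> [mf [M fM]]; exact: bounded_integrable mf fM. Qed.

End bounded_measurable.

Lemma measurable_all_le {d} {Om : measurableType d} {R : realType}
    (P : probability Om R) (n : nat) (X : 'I_n -> {RV P >-> R}) (z : R) :
  measurable [set w | forall i, X i w <= z].
Proof.
rewrite (_ : [set w | _] = \bigcap_(i in [set: 'I_n]) (X i @^-1` `]-oo, z])).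
  apply: fin_bigcap_measurable => // i _.
  by rewrite -[_ @^-1` _]setTI; apply: (measurable_funPT (X i)).
apply/seteqP; split => w /= h i; have := h i; rewrite /= in_itv/= => h'.
  by move=> _; exact: h'.
exact: h'.
Qed.

(** * Factorization of expectations when [rho = 0] *)

Section independence.
Context {d : measure_display} {Om : measurableType d} {R : realType}.
Variables (P : probability Om R) (n : nat) (X : 'I_n -> {RV P >-> R}).
Variables (mu : 'I_n -> R).
Hypothesis eqX : equicorrelated_normal P X mu 0.
Hypothesis mu0 : global_null mu.
Notation gam := (normal_prob (0:R) 1).

Let trig_bm f i : trig_closure f -> bounded_measurable (fun w => f (X i w)).
Proof.
move=> tf; split.
  apply: measurableT_comp; first exact: trig_measurable.
  exact: measurable_funPT.
by have [M fM] := trig_bounded tf; exists M.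
Qed.

Let cos_bm a b : bounded_measurable (fun w => cos (\sum_(i < n) a i * X i w + b)).
Proof.
split; last by exists 1 => w; exact: cos_norm_le1.
apply: (measurableT_comp (continuous_measurable_fun (@continuous_cos R))).
by apply: measurable_funD => //; exact: lincomb_measurable.
Qed.

Let gint_trig f : trig_closure f -> gam.-integrable setT (EFin \o f).
Proof.
move=> tf; have [M fM] := trig_bounded tf.
exact: (@bounded_integrable _ _ _ gam _ M (trig_measurable tf) fM).
Qed.

(* Adding one coordinate at a time, the joint characteristic function factorizes the
   expectation of products of functions in the closure of the cosines. *)
Lemma trig_factor (s : seq 'I_n) (F : 'I_n -> R -> R) : uniq s ->
  (forall i, trig_closure (F i)) -> forall (a : 'I_n -> R) (b : R),
  (forall i, i \in s -> a i = 0) ->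
  \int[P]_w (cos (\sum_(i < n) a i * X i w + b) * \prod_(i <- s) F i (X i w)) =
  cos b * expR (- ((\sum_(i < n) a i ^+ 2) / 2)) * \prod_(i <- s) \int[gam]_x F i x.
Proof.
move=> + tF; elim: s => [_ a b _|j s ih /= /andP[js us] a b].
  under eq_Rintegral do rewrite big_nil mulr1.
  rewrite (lincomb_cos eqX mu0) big_nil mulr1 /equicorr_form subr0 mul1r mul0r addr0 //.
have {}ih := ih us.
set G := fun w => \prod_(i <- s) F i (X i w).
set Gam := \prod_(i <- s) \int[gam]_x F i x.
have bG : bounded_measurable G by apply: bounded_measurable_prod => i; exact: trig_bm.
under eq_Rintegral do rewrite big_cons -/(G _).
rewrite big_cons -/Gam.
(* Inner induction on the membership of [F j] in the closure. If it is a cosine, the product-to-sum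
   formula absorbs [al * X j + be] into the linear form, whose coefficient at [j] was 0 and becomes
   [al] or [- al], and the hypothesis for [s] applies to both terms. Sums and multiples are linear;
   limits pass through both sides by bounded convergence. *)
elim: (tF j) a b => [al be|f g tf hf tg hg|k f tf hf|f g M tf hf fM fg] a b a0.
- have aj : a j = 0 by apply: a0; rewrite mem_head.
  pose a' (e : R) i := if i == j then e else a i.
  have a'0 e i : i \in s -> a' e i = 0.
    move=> si; rewrite /a'; case: eqP => [ij|_]; first by rewrite -ij si in js.
    by rewrite a0// inE si orbT.
  have lin e w : \sum_(i < n) a' e i * X i w = \sum_(i < n) a i * X i w + e * X j w.
    rewrite (bigD1 j)//= [in RHS](bigD1 j)//= aj mul0r add0r /a' eqxx addrC.
    by congr (_ + _); apply: eq_bigr => i /negbTE ->.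
  have sq e : \sum_(i < n) a' e i ^+ 2 = \sum_(i < n) a i ^+ 2 + e ^+ 2.
    rewrite (bigD1 j)//= [in RHS](bigD1 j)//= aj expr0n add0r /a' eqxx addrC.
    by congr (_ + _); apply: eq_bigr => i /negbTE ->.
  have E1 := ih (a' al) (b + be) (a'0 _); have E2 := ih (a' (- al)) (b - be) (a'0 _).
  transitivity (\int[P]_w (1 / 2 * (cos (\sum_(i < n) a' al i * X i w + (b + be)) * G w) +
     1 / 2 * (cos (\sum_(i < n) a' (- al) i * X i w + (b - be)) * G w))).
    apply: eq_Rintegral => w _; rewrite !lin.
    set A := \sum_(i < n) _.
    rewrite (_ : A + al * X j w + (b + be) = (A + b) + (al * X j w + be)); last by ring.
    rewrite (_ : A + - al * X j w + (b - be) = (A + b) - (al * X j w + be)); last by ring.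
    by rewrite (cosD (A + b)) (cosB (A + b)); field.
  have I e c : P.-integrable setT (EFin \o (fun w =>
      cos (\sum_(i < n) a' e i * X i w + c) * G w)).
    by apply: bounded_measurable_integrable; apply: bounded_measurableM.
  rewrite RintegralD//; [|exact: integrable_scaler|exact: integrable_scaler].
  rewrite RintegralZl// RintegralZl// E1 E2 !sq sqrrN gauss_cos -/Gam.
  set S := \sum_(i < n) _.
  rewrite (_ : - ((S + al ^+ 2) / 2) = - (S / 2) + - (al ^+ 2 / 2)); last by field.
  by rewrite expRD (cosD b be) (cosB b be); field.
- have I h : trig_closure h -> P.-integrable setT (EFin \o (fun w =>
      cos (\sum_(i < n) a i * X i w + b) * (h (X j w) * G w))).
    move=> th; apply: bounded_measurable_integrable; apply: bounded_measurableM => //.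
    by apply: bounded_measurableM => //; exact: trig_bm.
  under eq_Rintegral do rewrite mulrDl mulrDr.
  rewrite RintegralD//; [|exact: I|exact: I].
  rewrite hf// hg// RintegralD//; [|exact: gint_trig|exact: gint_trig].
  by rewrite mulrDl mulrDr.
- have I : P.-integrable setT (EFin \o (fun w =>
      cos (\sum_(i < n) a i * X i w + b) * (f (X j w) * G w))).
    apply: bounded_measurable_integrable; apply: bounded_measurableM => //.
    by apply: bounded_measurableM => //; exact: trig_bm.
  under eq_Rintegral do rewrite -mulrA mulrCA.
  by rewrite RintegralZl// hf// RintegralZl//; [ring|exact: gint_trig].
- have [_ [N GN]] := bG.
  have c1 : \int[P]_w (cos (\sum_(i < n) a i * X i w + b) * (f m (X j w) * G w)) @[m --> \oo]
      --> \int[P]_w (cos (\sum_(i < n) a i * X i w + b) * (g (X j w) * G w)).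
    apply: (@bounded_cvg_integral _ _ _ P _ _ (1 * (M * N))).
    + move=> m; apply: (proj1 (bounded_measurableM _ _)) => //.
      by apply: bounded_measurableM => //; exact: trig_bm.
    + by move=> m x; rewrite !normrM !ler_pM// cos_norm_le1.
    + move=> x; apply: cvgM; first exact: cvg_cst.
      by apply: cvgM; [exact: fg|exact: cvg_cst].
  have c2 : \int[gam]_x f m x @[m --> \oo] --> \int[gam]_x g x.
    apply: (@bounded_cvg_integral _ _ _ gam _ _ M) => // m.
    exact: (trig_measurable (tf m)).
  have c3 : cos b * expR (- ((\sum_(i < n) a i ^+ 2) / 2)) * (\int[gam]_x f m x * Gam)
      @[m --> \oo] --> cos b * expR (- ((\sum_(i < n) a i ^+ 2) / 2)) * (\int[gam]_x g x * Gam).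
    apply: cvgM; first exact: cvg_cst.
    by apply: cvgM; [exact: c2|exact: cvg_cst].
  apply: (cvg_unique (@Rhausdorff R) c1).
  apply: cvg_trans c3; apply: near_eq_cvg; apply: nearW => m.
  by rewrite hf.
Qed.

(** [trig_factor] with zero linear form and zero phase, so that the cosine is 1, and with all [F i]
    equal to the half-line indicator: the product of indicators is the indicator of the event. *)
Lemma prob_all_le (z : R) : P [set w | forall i, X i w <= z] = ((Phi z) ^+ n)%:E.
Proof.
set A := [set w | _].
have mA : measurable A := measurable_all_le X z.
have tF (i : 'I_n) := trig_itv z.
have := @trig_factor (enum 'I_n) _ (enum_uniq _) tF (fun=> 0) 0 (fun _ _ => erefl).
rewrite big1 => [|i _]; last by rewrite expr0n.
rewrite mul0r oppr0 expR0 cos0 !mul1r big_const_seq count_predT size_enum_ord iter_mulr_1.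
have -> : \int[gam]_x ((x <= z)%R : nat)%:R = Phi z.
  transitivity (fine (\int[gam]_x (\1_(`]-oo, z]%classic : set R) x)%:E)).
    by congr fine; apply: eq_integral => x _; rewrite indicE mem_setE in_itv.
  by rewrite (integral_indic gam measurableT (measurable_itv `]-oo, z])) setIT.
move=> <-; rewrite /Rintegral fineK; last first.
  apply: (integrable_fin_num measurableT); apply: bounded_measurable_integrable.
  apply: bounded_measurableM; last by apply: bounded_measurable_prod => i; exact: (trig_bm i (trig_itv z)).
  exact: (cos_bm (fun=> 0) 0).
transitivity (\int[P]_w (\1_A w)%:E)%E.
  by rewrite (integral_indic P measurableT mA) setIT.
apply: eq_integral => w _; congr (_%:E).
rewrite big1 ?addr0 ?cos0 ?mul1r => [|i _]; last by rewrite mul0r.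
rewrite big_enum/= indicE; have [wA|wA] := boolP (w \in A).
  by rewrite big1// => i _; move/set_mem : wA => /(_ i) ->.
have [i Xi] : exists i, ~~ (X i w <= z).
  apply/not_existsP => h; move/negP : wA; apply; apply/mem_set => i.
  by have /negP := h i; rewrite negbK.
by rewrite (bigD1 i)//= (negbTE Xi) mul0r.
Qed.

End independence.

(** * Step-up rejections as counting events *)

Lemma sorted_nth_le {R : realType} (s : seq R) (t : R) (k : nat) :
  sorted <=%R s -> (k < size s)%N ->
  (nth 0 s k <= t) = (k < count (fun x : R => (x <= t)%R) s)%N.
Proof.
elim: s k => [//|x s ih] k /= ps ks.
have xs : all (fun y => x <= y) s by apply: order_path_min ps; exact: le_trans.
have ss : sorted <=%R s by exact: path_sorted ps.
have [xt|tx] := leP x t.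
  by case: k ks => [//|k] ks; rewrite add1n ltnS; exact: ih.
have c0 : count (fun y => y <= t) s = 0%N.
  apply/eqP; rewrite -leqn0 leqNgt -has_count; apply/hasPn => y ys.
  by rewrite -ltNge (lt_le_trans tx)// (allP xs).
rewrite c0 addn0 ltn0; case: k ks => [|k] ks /=; first by apply/negbTE; rewrite -ltNge.
by rewrite ih// c0.
Qed.

(** Eliminates sorting: from here on order statistics are met only through counts. *)
Lemma ordered_pvalue_le {R : realType} {n : nat} (p : 'I_n -> R) (t : R) (i : nat) :
  (0 < i <= n)%N -> (ordered_pvalue p i <= t) = (i <= #|[pred j | (p j <= t)%R]|)%N.
Proof.
move=> /andP[i0 iN]; rewrite /ordered_pvalue sorted_nth_le.
- rewrite prednK// count_map /ordered_hyps; congr (_ <= _)%N.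
  have /permP -> : perm_eq (sort (fun i j => p i <= p j) (enum 'I_n)) (enum 'I_n).
    by rewrite perm_sort.
  by rewrite cardE -size_filter enumT.
- rewrite sorted_map; apply: sort_sorted => x y; exact: le_total.
- by rewrite size_map size_sort size_enum_ord prednK.
Qed.

(** Under the global null every rejection is an error, so an error occurs exactly when the step-up
    index is positive. The substitution [k = n - i + 1] turns the cutoff into [alpha / k] and the
    count condition [i <= count] into [n < k + count]. *)
Lemma hochberg_error {R : realType} {n : nat} (alpha : R) (mu x : 'I_n -> R) :
  global_null mu ->
  (1 <= type1_errors (hochberg n alpha) mu x)%N <->
  exists2 k : nat, (0 < k <= n)%N &
    (n < k + #|[pred j | (pvalue (x j) <= alpha / k%:R)%R]|)%N.
Proof.
move=> mu0; rewrite /type1_errors /hochberg /step_up.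
set p := fun j => pvalue (x j); set u := fun i : nat => _.
have -> : [set i in [set i in take (step_up_index u p) (ordered_hyps p)] | mu i == 0]%SET =
    [set i in take (step_up_index u p) (ordered_hyps p)]%SET.
  by apply/setP => i; rewrite !inE mu0 eqxx andbT.
have so : size (ordered_hyps p) = n by rewrite size_sort size_enum_ord.
split=> [|[k /andP[k0 kn] nk]].
  rewrite card_gt0 => /set0Pn[j]; rewrite inE => jt.
  have : (0 < step_up_index u p)%N by case: (step_up_index u p) jt => //; rewrite take0.
  rewrite /step_up_index lt0n => /negP H.
  have [i [i0 iN iu]] : exists i, [/\ (0 < i)%N, (i <= n)%N & ordered_pvalue p i <= u i].
    apply: contrapT => h; apply: H; rewrite big_nat_cond big1// => i /andP[/andP[i0 iN] iu].
    by exfalso; apply: h; exists i; split.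
  rewrite ordered_pvalue_le ?i0// in iu; exists (n - i + 1)%N; first by lia.
  by apply: leq_trans (leq_add (leqnn _) iu); lia.
have iu : ordered_pvalue p (n - k + 1) <= u (n - k + 1)%N.
  rewrite ordered_pvalue_le; last by lia.
  rewrite /u (_ : (n - (n - k + 1) + 1)%N = k); last by lia.
  have {}nk : (n < k + #|[pred j | (p j <= alpha / k%:R)%R]|)%N := nk.
  by lia.
have idx : (0 < step_up_index u p)%N.
  rewrite /step_up_index (big_rem (n - k + 1)%N)/=; last by rewrite mem_index_iota; lia.
  by rewrite iu leq_max; apply/orP; left; lia.
rewrite card_gt0; apply/set0Pn.
case E : (ordered_hyps p) so => [|j s] so; first by move: so => /=; lia.
exists j; rewrite inE; case: (step_up_index u p) idx => //= m _.
by rewrite mem_head.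
Qed.

Lemma pvalue_lt {R : realType} (z t x : R) : t < 1 - Phi z -> pvalue x <= t -> z < x.
Proof.
move=> tz xt; rewrite ltNge; apply/negP => /Phi_mono xz; rewrite /pvalue in xt; lra.
Qed.

(** The event is a union, over [k] and over the finitely many sets [S] of more than [n - k]
    hypotheses, of finite intersections of measurable events. *)
Lemma hochberg_event_measurable {d} {Om : measurableType d} {R : realType}
    (P : probability Om R) (n : nat) (X : 'I_n -> {RV P >-> R}) (mu : 'I_n -> R)
    (alpha : R) : global_null mu ->
  measurable [set w | (1 <= type1_errors (hochberg n alpha) mu (fun i => X i w))%N].
Proof.
move=> mu0.
pose B (t : R) j : set Om := [set w | pvalue (X j w) <= t].
have mB t j : measurable (B t j).
  have mF : measurable_fun setT (fun w => pvalue (X j w)).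
    apply: measurable_funB => //.
    apply: (@measurableT_comp _ _ _ _ _ _ (@Phi R)); last exact: measurable_funPT.
    by apply: nondecreasing_measurable => // x y; exact: Phi_mono.
  have -> : B t j = setT `&` (fun w => pvalue (X j w)) @^-1` `]-oo, t].
    by rewrite setTI; apply/seteqP; split => w /=; rewrite in_itv.
  exact: mF.
rewrite (_ : [set w | _] = \bigcup_(k in [set k | (0 < k <= n)%N])
    \bigcup_(S in [set S : {set 'I_n} | (n < k + #|S|)%N])
      \bigcap_(j in [set j | j \in S]) B (alpha / k%:R) j).
  apply: bigcup_measurable => k _.
  apply: fin_bigcup_measurable => // S _.
  by apply: fin_bigcap_measurable.
apply/seteqP; split => w /=.
  move/(hochberg_error _ _ mu0) => [k kn nk]; exists k => //.
  exists [set j | pvalue (X j w) <= alpha / k%:R]%SET.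
    by rewrite /= cardsE.
  by move=> j /=; rewrite inE.
move=> [k kn [S nS SB]]; apply/(hochberg_error _ _ mu0); exists k => //.
apply: (leq_trans nS); rewrite leq_add2l; apply: subset_leq_card.
by apply/fintype.subsetP => j jS; rewrite inE; exact: SB.
Qed.

(** * Concentration around the sample mean *)

(* [covered P E c] bounds the outer measure of [E], so [E] need not be measurable. *)
Definition covered {d} {T : measurableType d} {R : realType} (P : probability T R)
    (E : set T) (c : R) : Prop :=
  exists2 S, measurable S & E `<=` S /\ (P S <= c%:E)%E.

Section covered.
Context {d : measure_display} {T : measurableType d} {R : realType}.
Variable P : probability T R.
Implicit Types (E : set T) (c : R).

Lemma covered_measure E c : measurable E -> covered P E c -> (P E <= c%:E)%E.
Proof.
move=> mE [S mS [ES Sc]]; apply: le_trans Sc.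
by apply: le_measure; rewrite ?inE.
Qed.

Lemma covered_sub E E' c c' : E `<=` E' -> c' <= c -> covered P E' c' -> covered P E c.
Proof.
move=> EE' cc [S mS [ES Sc]]; exists S => //; split; first exact: subset_trans ES.
by rewrite (le_trans Sc)// lee_fin.
Qed.

Lemma coveredU E E' c c' : covered P E c -> covered P E' c' -> covered P (E `|` E') (c + c').
Proof.
move=> [S mS [ES Sc]] [S' mS' [ES' Sc']]; exists (S `|` S'); first exact: measurableU.
split; first exact: setUSS.
apply: (le_trans (measureU2 _ _ _)) => //.
by rewrite EFinD leeD.
Qed.

Lemma covered_markov (f : T -> R) (v c : R) :
  measurable_fun setT f -> (forall w, 0 <= f w) -> 0 < c ->
  (\int[P]_w (f w)%:E <= v%:E)%E -> covered P [set w | c <= f w] (v / c).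
Proof.
move=> mf f0 c0 fv.
have mS : measurable [set w | c <= f w].
  rewrite -[X in measurable X]setTI.
  have -> : [set w | c <= f w] = f @^-1` `[c, +oo[.
    by apply/seteqP; split => w /=; rewrite in_itv/= andbT.
  exact: mf.
exists [set w | c <= f w] => //; split => //.
rewrite mulrC EFinM lee_pdivlMl//; apply: le_trans fv.
exact: markov_set.
Qed.

End covered.

(** * Exponentials of linear combinations, and deviations from the sample mean *)

Definition exp_lincomb {d} {Om : measurableType d} {R : realType} {P : probability Om R}
    {n : nat} (X : 'I_n -> {RV P >-> R}) (a : 'I_n -> R) (w : Om) : R :=
  expR (\sum_(l < n) a l * X l w).

(* Coefficients of [X i] minus the sample mean. *)
Definition dev {R : realType} {n : nat} (i l : 'I_n) : R := (l == i)%:R - n%:R^-1.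

Section exp_sums.
Context {d : measure_display} {Om : measurableType d} {R : realType}.
Variables (P : probability Om R) (n : nat) (X : 'I_n -> {RV P >-> R}).
Variables (mu : 'I_n -> R) (rho : R).
Hypothesis eqX : equicorrelated_normal P X mu rho.
Hypothesis mu0 : global_null mu.
Implicit Types a : 'I_n -> R.

Local Notation E := (exp_lincomb X).

Lemma measurable_exp_lincomb a : measurable_fun setT (E a).
Proof.
apply: (measurableT_comp (continuous_measurable_fun (@continuous_expR R))).
exact: lincomb_measurable.
Qed.

Lemma integrable_exp_lincomb a : P.-integrable setT (EFin \o E a).
Proof.
apply/integrableP; split.
  by apply/measurable_EFinP; exact: measurable_exp_lincomb.
under eq_integral do rewrite /= ger0_norm ?expR_ge0//.
by rewrite (lincomb_mgf eqX mu0) ltry.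
Qed.

Lemma exp_lincomb_sum (I : Type) (s : seq I) (a : I -> 'I_n -> R) :
  P.-integrable setT (EFin \o (fun w => \sum_(i <- s) E (a i) w)) /\
  \int[P]_w (\sum_(i <- s) E (a i) w) = \sum_(i <- s) expR (equicorr_form rho (a i) / 2).
Proof.
have [h1 h2] := Rintegral_sum s (fun i => integrable_exp_lincomb (a i)).
split => //; rewrite h2; apply: eq_bigr => i _.
by rewrite /Rintegral (lincomb_mgf eqX mu0).
Qed.

Lemma covered_exp_sum (I : Type) (s : seq I) (a : I -> 'I_n -> R) (v c : R) : 0 < c ->
  \sum_(i <- s) expR (equicorr_form rho (a i) / 2) <= v ->
  covered P [set w | c <= \sum_(i <- s) E (a i) w] (v / c).
Proof.
move=> c0 sv; have [h1 h2] := exp_lincomb_sum s a.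
apply: covered_markov => //.
- by apply: measurable_sum => i; exact: measurable_exp_lincomb.
- by move=> w; apply: sumr_ge0 => i _; exact: expR_ge0.
- rewrite -[leLHS]fineK; last exact: (integrable_fin_num measurableT h1).
  by rewrite lee_fin -/(Rintegral _ _ _) h2.
Qed.

Hypothesis n1 : (0 < n)%N.
Let n0 : (n%:R : R) != 0. Proof. by rewrite pnatr_eq0 -lt0n. Qed.

(** [dev i] is the i-th unit vector projected orthogonally to the constants, so the Gram matrix is
    the matrix of that projection. *)
Lemma dev_inner (i j : 'I_n) :
  \sum_l dev i l * dev j l = (i == j)%:R - n%:R^-1 :> R.
Proof.
transitivity (\sum_(l < n) ((l == i)%:R * (l == j)%:R - n%:R^-1 * ((l == i)%:R + (l == j)%:R)
   + n%:R^-1 ^+ 2 : R)).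
  by apply: eq_bigr => l _; rewrite /dev; ring.
rewrite big_split sumrB -mulr_sumr big_split/= sumr_const card_ord.
have D k : \sum_(l < n) (l == k)%:R = 1 :> R.
  by rewrite (bigD1 k)//= eqxx big1 ?addr0// => l /negbTE ->.
rewrite !D (bigD1 i)//= eqxx mul1r big1 ?addr0 => [|l /negbTE ->]; last by rewrite mul0r.
by rewrite -[_ *+ n]mulr_natr; field.
Qed.

Lemma dev_sum (i : 'I_n) : \sum_l dev i l = 0 :> R.
Proof.
rewrite sumrB sumr_const card_ord (bigD1 i)//= eqxx big1 ?addr0 => [|l /negbTE -> //].
by rewrite -[_^-1 *+ n]mulr_natr mulVf ?subrr.
Qed.

Lemma dev_lincomb (c : R) (i : 'I_n) w :
  \sum_(l < n) (c * dev i l) * X l w = c * (X i w - n%:R^-1 * \sum_(l < n) X l w).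
Proof.
under eq_bigr do rewrite -mulrA; rewrite -mulr_sumr; congr (_ * _).
under eq_bigr do rewrite /dev mulrBl; rewrite sumrB -mulr_sumr; congr (_ - _).
by rewrite (bigD1 i)//= eqxx mul1r big1 ?addr0 => [//|l /negbTE ->]; rewrite mul0r.
Qed.

(** The coefficients of a deviation sum to 0, so the common-factor term [rho] times the squared sum
    vanishes. *)
Lemma form_dev (c : R) (i : 'I_n) :
  equicorr_form rho (fun l => c * dev i l) = (1 - rho) * c ^+ 2 * (1 - n%:R^-1).
Proof.
rewrite /equicorr_form -mulr_sumr dev_sum mulr0 expr0n mulr0 addr0 -mulrA; congr (_ * _).
under eq_bigr do rewrite exprMn expr2 [dev _ _ ^+ 2]expr2.
by rewrite -mulr_sumr dev_inner eqxx.
Qed.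

Lemma form_dev2 (c : R) (i j : 'I_n) :
  equicorr_form rho (fun l => c * dev i l + c * dev j l) =
  (1 - rho) * c ^+ 2 * (2 + 2 * (i == j)%:R - 4 * n%:R^-1).
Proof.
rewrite /equicorr_form big_split/= -!mulr_sumr !dev_sum !mulr0 addr0 expr0n mulr0 addr0.
rewrite -mulrA; congr (_ * _).
transitivity (\sum_l (c ^+ 2 * (dev i l * dev i l) + c ^+ 2 * (dev j l * dev j l)
   + c ^+ 2 * 2 * (dev i l * dev j l))).
  by apply: eq_bigr => l _; ring.
rewrite !big_split/= -!mulr_sumr !dev_inner !eqxx.
have -> : (true%:R : R) = 1 by [].
set b : R := (i == j)%:R; ring.
Qed.

End exp_sums.

(** * It is unlikely that nearly all observations exceed a fixed level *)

Section few_below.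
Context {d : measure_display} {Om : measurableType d} {R : realType}.
Variables (P : probability Om R) (n : nat) (X : 'I_n -> {RV P >-> R}).
Variables (mu : 'I_n -> R) (rho : R).
Hypothesis eqX : equicorrelated_normal P X mu rho.
Hypothesis mu0 : global_null mu.
Hypothesis rho1 : rho < 1.
Hypothesis n1 : (0 < n)%N.

Let nR0 : 0 < n%:R :> R. Proof. by rewrite ltr0n. Qed.
Let inv_n0 : 0 < n%:R^-1 :> R. Proof. by rewrite invr_gt0. Qed.
Let inv_n1 : n%:R^-1 <= 1 :> R. Proof. by rewrite invf_le1// ler1n. Qed.

(** The sample mean has variance [(1 - rho) / n + rho], at most 1; this is Chernoff's bound with
    parameter 1. *)
Lemma covered_mean (M : R) :
  covered P [set w | M <= n%:R^-1 * \sum_(l < n) X l w] (expR (1 / 2 - M)).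
Proof.
have H := covered_exp_sum eqX mu0 (s := [:: tt]) (a := fun _ _ => n%:R^-1)
  (v := expR (1 / 2)) (expR_gt0 M).
rewrite expRD expRN; apply: covered_sub (lexx _) (H _).
- by move=> w /=; rewrite big_seq1 /exp_lincomb ler_expR mulr_sumr.
- rewrite big_seq1 ler_expR ler_pM2r ?invr_gt0//.
  rewrite /equicorr_form !sumr_const !card_ord -[_ ^+ 2 *+ n]mulr_natr -[_^-1 *+ n]mulr_natr.
  rewrite mulVf ?gt_eqF// expr1n mulr1 expr2 -mulrA mulVf ?gt_eqF// mulr1.
  have : (1 - rho) * n%:R^-1 <= (1 - rho) * 1 by rewrite ler_wpM2l// subr_ge0 ltW.
  lra.
Qed.

Lemma covered_dev_sum (lam c : R) : 0 < c ->
  covered P [set w | c <= \sum_(i < n) exp_lincomb X (fun l => lam * dev i l) w]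
    (n%:R * expR ((1 - rho) * lam ^+ 2 / 2) / c).
Proof.
move=> c0; apply: (covered_exp_sum eqX mu0 (a := fun i l => lam * dev i l)) => //.
under eq_bigr do rewrite form_dev//.
rewrite sumr_const card_ord -[expR _ *+ n]mulr_natl ler_pM2l// ler_expR ler_pM2r ?invr_gt0//.
apply: ler_piMr; last by rewrite gerBl ltW.
by rewrite mulr_ge0 ?sqr_ge0// subr_ge0 ltW.
Qed.

(** Chebyshev's inequality for the sum at distance half its mean [n * m]. Distinct deviations are
    negatively correlated, so off-diagonal pairs contribute at most [m ^+ 2] each to the second
    moment, and the variance is at most the diagonal part [n * expR (2 * v)]. *)
Lemma covered_dev_sum_lower (lam : R) :
  covered P [set w | \sum_(i < n) exp_lincomb X (fun l => lam * dev i l) w <=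
      n%:R * expR ((1 - rho) * lam ^+ 2 * (1 - n%:R^-1) / 2) / 2]
    (4 * expR ((1 - rho) * lam ^+ 2) / n%:R).
Proof.
pose a (i l : 'I_n) : R := lam * dev i l.
set v := (1 - rho) * lam ^+ 2 * (1 - n%:R^-1).
set m := expR (v / 2); have m0 : 0 < m := expR_gt0 _.
pose G w := \sum_(i < n) exp_lincomb X (a i) w.
pose a2 (ij : 'I_n * 'I_n) l := a ij.1 l + a ij.2 l.
have [i1 E1] := exp_lincomb_sum eqX mu0 (index_enum 'I_n) a.
have [i2 E2] := exp_lincomb_sum eqX mu0 (index_enum ('I_n * 'I_n)%type) a2.
have G2 w : G w ^+ 2 = \sum_(ij : 'I_n * 'I_n) exp_lincomb X (a2 ij) w.
  rewrite /G expr2 big_distrlr/= pair_big/=; apply: eq_bigr => ij _.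
  rewrite /exp_lincomb -expRD -big_split/=; congr expR.
  by apply: eq_bigr => l _; rewrite /a2 mulrDl.
have sq w : (G w - n%:R * m) ^+ 2 =
    \sum_(ij : 'I_n * 'I_n) exp_lincomb X (a2 ij) w + (- 2 * (n%:R * m)) * G w + (n%:R * m) ^+ 2.
  by rewrite -G2; ring.
have mG : measurable_fun setT G.
  by apply: measurable_sum => i; exact: measurable_exp_lincomb.
have intsq : \int[P]_w ((G w - n%:R * m) ^+ 2) <= n%:R * expR (2 * v).
  under eq_Rintegral do rewrite sq.
  have iG : P.-integrable setT (EFin \o (fun w => (- 2 * (n%:R * m)) * G w)).
    exact: integrable_scaler.
  rewrite RintegralD//; last 2 first.
  - exact: integrable_addr.
  - exact: finite_measure_integrable_cst.
  rewrite RintegralD// RintegralZl// E2 E1 Rintegral_cst//.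
  rewrite (congr1 fine (probability_setT P)) mulr1.
  have -> : \sum_(i < n) expR (equicorr_form rho (a i) / 2) = n%:R * m.
    under eq_bigr do rewrite form_dev//.
    by rewrite sumr_const card_ord -[expR _ *+ n]mulr_natl.
  suff : \sum_(ij : 'I_n * 'I_n) expR (equicorr_form rho (a2 ij) / 2) <=
      n%:R * expR (2 * v) + (n%:R * m) ^+ 2 by move=> h; nra.
  rewrite -(pair_big xpredT xpredT (fun i j => expR (equicorr_form rho (a2 (i, j)) / 2)))/=.
  have -> : n%:R * expR (2 * v) + (n%:R * m) ^+ 2 =
      \sum_(i < n) (expR (2 * v) + \sum_(j < n) m ^+ 2).
    by rewrite big_split/= !sumr_const !card_ord -[expR _ *+ n]mulr_natl -[_ ^+ 2 *+ n]mulr_natl -[_ *+ n in RHS]mulr_natl; ring.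
  apply: ler_sum => i _; rewrite (bigD1 i)//= [X in _ <= _ + X](bigD1 i)//= addrA.
  apply: lerD.
    rewrite ler_wpDr ?sqr_ge0// ler_expR form_dev2// eqxx /v.
    have -> : (true%:R : R) = 1 by [].
    by rewrite le_eqVlt; apply/orP; left; apply/eqP; field; rewrite gt_eqF.
  apply: ler_sum => j ji; rewrite form_dev2// eq_sym (negbTE ji).
  rewrite /m -expRM_natl ler_expR /v.
  have h : 0 <= (1 - rho) * lam ^+ 2 by rewrite mulr_ge0 ?sqr_ge0// subr_ge0 ltW.
  have h2 : 0 <= (1 - rho) * lam ^+ 2 * n%:R^-1 by rewrite mulr_ge0// ltW.
  have -> : (false%:R : R) = 0 by [].
  nra.
have isq : P.-integrable setT (EFin \o (fun w => (G w - n%:R * m) ^+ 2)).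
  under eq_fun do rewrite sq.
  apply: integrable_addr; last exact: finite_measure_integrable_cst.
  by apply: integrable_addr => //; exact: integrable_scaler.
have c0 : 0 < (n%:R * m / 2) ^+ 2 by rewrite exprn_gt0// divr_gt0// mulr_gt0.
have := @covered_markov _ _ _ P (fun w => (G w - n%:R * m) ^+ 2) (n%:R * expR (2 * v))
  ((n%:R * m / 2) ^+ 2).
move=> H; apply: covered_sub (H _ _ c0 _).
- move=> w /= hw.
  have G0 : 0 <= G w by apply: sumr_ge0 => i _; exact: expR_ge0.
  have nm0 : 0 < n%:R * m by rewrite mulr_gt0.
  rewrite -[leRHS]sqrrN ler_sqr ?nnegrE ?divr_ge0 ?(ltW nm0)//.
    by rewrite -/(G w) in hw; lra.
  by rewrite -/(G w) in hw; lra.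
- have -> : n%:R * expR (2 * v) / (n%:R * m / 2) ^+ 2 = 4 * expR v / n%:R.
    have -> : expR (2 * v) = expR v * m ^+ 2.
      by rewrite /m -expRM_natl -expRD; congr expR; field.
    by field; rewrite !gt_eqF.
  rewrite ler_pM2r// ler_pM2l// ler_expR /v; apply: ler_piMr; last by rewrite gerBl ltW.
  by rewrite mulr_ge0 ?sqr_ge0// subr_ge0 ltW.
- by apply: measurable_funX; apply: measurable_funB.
- by move=> w; exact: sqr_ge0.
- rewrite -[leLHS]fineK; last exact: (integrable_fin_num measurableT isq).
  by rewrite lee_fin.
Qed.

(** The three error terms belong to three bad events: the mean reaches [M], the sum with exponent
    [2 * lam] reaches [n * K], the sum with exponent [lam] is below half its mean. If the first two
    fail and nearly all [X i] are at least [tau], then most deviations exceed [tau - M], which makes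
    the last sum small and forces the third event. *)
Lemma few_below (tau M lam K : R) : (2 <= n)%N -> 0 < lam -> 0 < K ->
  expR (lam * (M - tau)) + 2 < expR ((1 - rho) * lam ^+ 2 / 4) / 2 ->
  covered P [set w | n%:R * (1 - K^-1) <= #|[pred i | tau <= X i w]|%:R]
    (expR (1 / 2 - M) + expR ((1 - rho) * (2 * lam) ^+ 2 / 2) / K +
     4 * expR ((1 - rho) * lam ^+ 2) / n%:R).
Proof.
move=> n2 lam0 K0 hlam.
have c2 : 0 < n%:R * K by rewrite mulr_gt0.
have c1 : covered P [set w | n%:R * K <= \sum_(i < n) exp_lincomb X (fun l => - (2 * lam) * dev i l) w]
    (expR ((1 - rho) * (2 * lam) ^+ 2 / 2) / K).
  apply: covered_sub (covered_dev_sum (- (2 * lam)) c2) => //.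
  by rewrite sqrrN le_eqVlt; apply/orP; left; apply/eqP; field; rewrite !gt_eqF.
have c3 := covered_dev_sum_lower (- lam); rewrite sqrrN in c3.
apply: covered_sub (lexx _) (coveredU (coveredU (covered_mean M) c1) c3).
move=> w /= hw.
case: (leP M (n%:R^-1 * \sum_(l < n) X l w)) => hM; first by left; left.
case: (leP (n%:R * K) (\sum_(i < n) exp_lincomb X (fun l => - (2 * lam) * dev i l) w)) => hK.
  by left; right.
right.
pose Y i := X i w - n%:R^-1 * \sum_(l < n) X l w.
have EW i : exp_lincomb X (fun l => - lam * dev i l) w = expR (- lam * Y i).
  by rewrite /exp_lincomb dev_lincomb.
have EW2 i : exp_lincomb X (fun l => - (2 * lam) * dev i l) w = expR (- lam * Y i) ^+ 2.
  by rewrite /exp_lincomb dev_lincomb// -expRM_natl; congr expR; rewrite /Y; ring.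
under eq_bigr do rewrite EW.
have {}hK : \sum_(i < n) expR (- lam * Y i) ^+ 2 < n%:R * K.
  by under eq_bigr do rewrite -EW2.
(* Indices with [X i w >= tau] are bounded through the mean. For the others, [W <= K + W ^+ 2 / K]
   follows from [(W - K) ^+ 2 >= 0]: there are at most [n / K] of them, so the terms [K] add up to
   at most [n], and so do the terms [W ^+ 2 / K]. *)
have bound i : expR (- lam * Y i) <= expR (lam * (M - tau)) + (~~ (tau <= X i w)%R)%:R * K + K^-1 * expR (- lam * Y i) ^+ 2.
  set W := expR _; have W0 : 0 < W := expR_gt0 _.
  case: (leP tau (X i w)) => hX /=.
    rewrite mul0r addr0; apply: ler_wpDr.
      by rewrite mulr_ge0 ?sqr_ge0 ?invr_ge0 ?ltW.
    rewrite /W ler_expR mulNr -mulrN ler_pM2l// /Y; lra.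
  rewrite mul1r -addrA; apply: ler_wpDl; first exact: expR_ge0.
  have : 0 <= K^-1 * (W - K) ^+ 2 by rewrite mulr_ge0 ?sqr_ge0 ?invr_ge0 ?ltW.
  have -> : K^-1 * (W - K) ^+ 2 = K^-1 * W ^+ 2 - 2 * W + K by field; rewrite gt_eqF.
  lra.
have S : \sum_(i < n) expR (- lam * Y i) <= n%:R * expR (lam * (M - tau)) + n%:R + n%:R.
  apply: (le_trans (ler_sum _ (fun i _ => bound i))).
  rewrite !big_split/= sumr_const card_ord -[_ *+ n]mulr_natl -!addrA lerD2l.
  apply: lerD; last by rewrite -mulr_sumr mulrC ler_pdivrMr// ltW.
  rewrite -mulr_suml.
  have -> : \sum_(i < n) (~~ (tau <= X i w)%R)%:R = n%:R - #|[pred i | tau <= X i w]|%:R :> R.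
    rewrite -natr_sum -[in n%:R](card_ord n) -(cardC [pred i | tau <= X i w]) natrD addrAC subrr add0r.
    congr (_%:R); rewrite -[RHS]sum1_card [RHS]big_mkcond/=.
    by apply: eq_bigr => i _; rewrite !inE; case: (_ <= _).
  rewrite -ler_pdivlMr// -[n%:R / K]opprK.
  have -> : n%:R / K = n%:R - n%:R * (1 - K^-1) by ring.
  lra.
apply: (le_trans S).
(* [n >= 2] gives [1 - n^-1 >= 1 / 2], whence the constant 4 in the hypothesis on [lam]. *)
have : expR ((1 - rho) * lam ^+ 2 / 4) <= expR ((1 - rho) * lam ^+ 2 * (1 - n%:R^-1) / 2).
  rewrite ler_expR.
  have h : 0 <= (1 - rho) * lam ^+ 2 by rewrite mulr_ge0 ?sqr_ge0// subr_ge0 ltW.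
  have i2 : n%:R^-1 <= 1 / 2 :> R.
    by rewrite mul1r lef_pV2 ?posrE ?ltr0n// ler_nat.
  nra.
set m := expR (_ * (1 - _) / 2); move=> hm.
have : n%:R * (expR (lam * (M - tau)) + 2) <= n%:R * (m / 2) by rewrite ler_pM2l//; lra.
lra.
Qed.

End few_below.

Lemma nat_ge {R : realType} (x : R) : exists N : nat, forall n, (N <= n)%N -> x <= n%:R.
Proof.
exists (Num.bound `|x|) => n Nn; apply: (le_trans (ler_norm x)).
apply: (le_trans (ltW (archi_boundP (normr_ge0 x)))).
by rewrite ler_nat.
Qed.

(** The constants of [few_below] are chosen in the order [M], [lam], [K], [N], each of the three
    error terms becoming at most [eta / 3]; then [delta = K^-1]. They depend only on [rho], [tau]
    and [eta], hence hold for all models at once. *)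
Lemma covered_count {R : realType} (rho tau eta : R) :
  rho < 1 -> 0 < eta ->
  exists (delta : R) (N : nat), [/\ 0 < delta, delta < 1 &
    forall (n : nat) (d : measure_display) (Om : measurableType d) (P : probability Om R)
      (X : 'I_n -> {RV P >-> R}) (mu : 'I_n -> R),
    equicorrelated_normal P X mu rho -> global_null mu -> (N <= n)%N ->
    covered P [set w | n%:R * (1 - delta) <= #|[pred i | tau <= X i w]|%:R] eta].
Proof.
move=> rho1 eta0.
pose M := 1 / 2 - ln (eta / 3).
have e3 : 0 < eta / 3 by rewrite divr_gt0.
have EM : expR (1 / 2 - M) = eta / 3.
  by rewrite /M opprB addrCA subrr addr0 lnK.
pose q := (1 - rho) / 4; have q0 : 0 < q by rewrite divr_gt0// subr_gt0.
pose B := `|M - tau|; have B0 : 0 <= B := normr_ge0 _.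
(* Makes [q * lam = B + 6 + q], so the quadratic exponent exceeds [lam * B + 6]; the bound
   [expR 6 >= 7] then absorbs the summand 2 and the factor 1/2. *)
pose lam := (B + 6) / q + 1.
have lam1 : 1 <= lam by rewrite lerDr; apply: divr_ge0; [exact: addr_ge0|exact: ltW].
have lam0 : 0 < lam by rewrite (lt_le_trans ltr01).
have hlam : expR (lam * (M - tau)) + 2 < expR ((1 - rho) * lam ^+ 2 / 4) / 2.
  have h1 : lam * (M - tau) <= lam * B by rewrite ler_pM2l// ler_norm.
  have h2 : lam * B + 6 <= (1 - rho) * lam ^+ 2 / 4.
    have -> : (1 - rho) * lam ^+ 2 / 4 = lam * (q * lam) by rewrite /q; field.
    have -> : q * lam = B + 6 + q by rewrite /lam; field; rewrite gt_eqF.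
    have : 0 <= lam * q by rewrite mulr_ge0// ltW.
    nra.
  rewrite -ler_expR in h1; rewrite -ler_expR expRD in h2.
  have h3 : 1 <= expR (lam * B) by rewrite -expR0 ler_expR mulr_ge0// ltW.
  have h4 : 7 <= expR 6 :> R by apply: le_trans (expR_ge1Dx _); lra.
  have h5 : 0 <= (expR (lam * B) - 1) * (expR 6 - 7) by rewrite mulr_ge0// subr_ge0.
  nra.
pose E2 := expR ((1 - rho) * (2 * lam) ^+ 2 / 2); have E20 : 0 < E2 := expR_gt0 _.
pose K := E2 / (eta / 3) + 1.
have K1 : 1 < K by rewrite ltrDr divr_gt0.
have K0 : 0 < K by rewrite (lt_trans ltr01).
have [N hN] := nat_ge (4 * expR ((1 - rho) * lam ^+ 2) / (eta / 3)).
exists K^-1, (maxn N 2); split; first by rewrite invr_gt0.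
  by rewrite invf_lt1.
move=> n d Om P X mu eqX mu0; rewrite geq_max => /andP[Nn n2].
have n0 : (0 < n)%N by exact: leq_trans n2.
apply: covered_sub (few_below eqX mu0 rho1 n0 n2 lam0 K0 hlam); first by [].
rewrite EM.
have b1 : E2 / K <= eta / 3.
  rewrite ler_pdivrMr// /K mulrDr mulr1 mulrC divfK ?gt_eqF//.
  by rewrite lerDl ltW.
have b2 : 4 * expR ((1 - rho) * lam ^+ 2) / n%:R <= eta / 3.
  rewrite ler_pdivrMr ?ltr0n// [leRHS]mulrC -ler_pdivrMr//.
  exact: hN.
rewrite -/E2; lra.
Qed.

(** * Bounds for the maximum and for the number of large observations *)

(** If the mean is below [M] and [X j > z], the single term [j] of the exponential sum already
    exceeds [expR (kap * (z - M))]; Markov's inequality for the sum acts as a union bound over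
    [j]. *)
Lemma covered_max {d} {Om : measurableType d} {R : realType} (P : probability Om R)
    (n : nat) (X : 'I_n -> {RV P >-> R}) (mu : 'I_n -> R) (rho z M kap : R) :
  equicorrelated_normal P X mu rho -> global_null mu -> rho < 1 ->
  (0 < n)%N -> 0 < kap ->
  covered P [set w | exists j, z < X j w]
    (expR (1 / 2 - M) + n%:R * expR ((1 - rho) * kap ^+ 2 / 2) / expR (kap * (z - M))).
Proof.
move=> eqX mu0 rho1 n0 kap0.
apply: covered_sub (lexx _) (coveredU (covered_mean eqX mu0 rho1 n0 M)
  (covered_dev_sum eqX mu0 rho1 n0 kap (expR_gt0 _))).
move=> w /= [j zj].
case: (leP M (n%:R^-1 * \sum_(l < n) X l w)) => hM; [by left|right].
rewrite (bigD1 j)//=; apply: ler_wpDr; first by apply: sumr_ge0 => i _; exact: expR_ge0.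
by rewrite /exp_lincomb dev_lincomb// ler_expR ler_pM2l//; lra.
Qed.

(** Markov's inequality for the sum of the [expR (X i)], in which each observation above [z]
    contributes at least [expR z]. *)
Lemma covered_many {d} {Om : measurableType d} {R : realType} (P : probability Om R)
    (n : nat) (X : 'I_n -> {RV P >-> R}) (mu : 'I_n -> R) (rho z eps : R) :
  equicorrelated_normal P X mu rho -> global_null mu -> (0 < n)%N -> 0 < eps ->
  covered P [set w | n%:R * eps <= #|[pred j | z < X j w]|%:R] (expR (1 / 2 - z) / eps).
Proof.
move=> eqX mu0 n0 eps0; have nR : 0 < n%:R :> R by rewrite ltr0n.
pose a (i l : 'I_n) : R := (l == i)%:R.
have D (i : 'I_n) f : \sum_l a i l * f l = f i :> R.
  by rewrite (bigD1 i)//= /a eqxx mul1r big1 ?addr0// => l /negbTE ->; rewrite mul0r.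
have c0 : 0 < n%:R * eps * expR z by rewrite !mulr_gt0// expR_gt0.
apply: covered_sub (covered_exp_sum eqX mu0 (s := index_enum 'I_n) (a := a)
  (v := n%:R * expR (1 / 2)) c0 _).
- move=> w /= hw.
  apply: (@le_trans _ _ (#|[pred j | z < X j w]|%:R * expR z)).
    by rewrite ler_pM2r// expR_gt0.
  rewrite -sum1_card natr_sum mulr_suml big_mkcond/=; apply: ler_sum => i _.
  rewrite /exp_lincomb D inE; case: ltP => h; last exact: expR_ge0.
  by rewrite mul1r ler_expR ltW.
- rewrite expRD expRN le_eqVlt; apply/orP; left; apply/eqP.
  by field; rewrite !gt_eqF// expR_gt0.
- have F i : equicorr_form rho (a i) = 1.
    rewrite /equicorr_form.
    have -> : \sum_l a i l ^+ 2 = 1 by under eq_bigr do rewrite expr2; rewrite D /a eqxx.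
    have -> : \sum_l a i l = 1 by under eq_bigr do rewrite -[a i _]mulr1; rewrite D.
    by rewrite expr1n; ring.
  under eq_bigr do rewrite F.
  by rewrite sumr_const card_ord -[expR _ *+ n]mulr_natl.
Qed.

Lemma cvg_ereal_near {R : realType} (u : nat -> \bar R) (l : R) :
  (forall e, 0 < e -> exists N, forall n, (N <= n)%N ->
    ((l - e)%:E <= u n)%E /\ (u n <= (l + e)%:E)%E) ->
  u n @[n --> \oo] --> l%:E.
Proof.
move=> H.
have fin e n : ((l - e)%:E <= u n)%E -> (u n <= (l + e)%:E)%E -> u n \is a fin_num.
  by case: (u n).
apply: cvg_EFin.
  have [N hN] := H 1 ltr01; exists N => // n /= Nn; have [h1 h2] := hN n Nn.
  exact: fin h1 h2.
apply/cvgrPdist_le => e e0; have [N hN] := H e e0; exists N => // n /= Nn.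
have [h1 h2] := hN n Nn; have := fin _ _ h1 h2; move: h1 h2.
case: (u n) => //= r; rewrite !lee_fin => h1 h2 _.
by rewrite distrC ler_distl; apply/andP; split.
Qed.

(** * Hochberg's procedure *)

Definition hochberg_event {d} {Om : measurableType d} {R : realType}
    {P : probability Om R} {n : nat} (X : 'I_n -> {RV P >-> R}) (alpha : R) : set Om :=
  [set w | exists2 k : nat, (0 < k <= n)%N &
    (n < k + #|[pred j | (pvalue (X j w) <= alpha / k%:R)%R]|)%N].

Lemma FWER_hochberg {d} {Om : measurableType d} {R : realType}
    (P : probability Om R) (n : nat) (X : 'I_n -> {RV P >-> R}) (mu : 'I_n -> R)
    (alpha : R) : global_null mu ->
  measurable (hochberg_event X alpha) /\
  FWER P X mu (hochberg n alpha) = P (hochberg_event X alpha).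
Proof.
move=> mu0; have mE := hochberg_event_measurable X alpha mu0.
have E : [set w | (1 <= type1_errors (hochberg n alpha) mu (fun i => X i w))%N] =
    hochberg_event X alpha.
  by apply/seteqP; split => w /=; apply hochberg_error.
by rewrite /FWER E -E.
Qed.

Lemma card_pvalue_le {R : realType} (n : nat) (x : 'I_n -> R) (t s z : R) :
  t <= s -> s < 1 - Phi z ->
  (#|[pred j | (pvalue (x j) <= t)%R]| <= #|[pred j | (z < x j)%R]|)%N.
Proof.
move=> ts sz; apply: subset_leq_card; apply/fintype.subsetP => j; rewrite !inE => h.
exact: (pvalue_lt sz (le_trans h ts)).
Qed.

(** The cutoff [alpha / k] is replaced by the larger [alpha]; what matters for small [k] is that
    nearly all p-values must be below it. *)
Lemma early_regime {R : realType} (n k : nat) (x : 'I_n -> R) (alpha delta tau : R) :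
  0 < alpha -> alpha < 1 - Phi tau -> (0 < k <= n)%N ->
  (n < k + #|[pred j | (pvalue (x j) <= alpha / k%:R)%R]|)%N ->
  k%:R <= n%:R * delta ->
  n%:R * (1 - delta) <= #|[pred i | tau <= x i]|%:R.
Proof.
move=> a0 at1 /andP[k0 kn] nk kd.
have ak : alpha / k%:R <= alpha.
  by rewrite ler_pdivrMr ?ltr0n// ler_peMr ?ler1n// ltW.
have h1 := card_pvalue_le x ak at1.
have h2 : (#|[pred j | (tau < x j)%R]| <= #|[pred j | (tau <= x j)%R]|)%N.
  by apply: subset_leq_card; apply/fintype.subsetP => j; rewrite !inE; exact: ltW.
have : n%:R <= k%:R + #|[pred i | (tau <= x i)%R]|%:R :> R.
  by rewrite -natrD ler_nat; lia.
rewrite mulrBr mulr1; lra.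
Qed.

Lemma some_pvalue {R : realType} (n k : nat) (x : 'I_n -> R) (t s z : R) :
  (k <= n)%N -> (n < k + #|[pred j | (pvalue (x j) <= t)%R]|)%N ->
  t <= s -> s < 1 - Phi z -> exists j, z < x j.
Proof.
move=> kn nk ts sz.
have /card_gt0P[j] : (0 < #|[pred j | (z < x j)%R]|)%N.
  by have := card_pvalue_le x ts sz; lia.
by rewrite inE; exists j.
Qed.

Lemma quadratic_dominates {R : realType} (g h L : R) : 0 < g ->
  exists w0, forall w, w0 <= w -> h * w + L <= g * w ^+ 2 / 2.
Proof.
move=> g0; pose c := 2 * (`|h| + `|L|) / g.
have c0 : 0 <= c by rewrite divr_ge0 ?mulr_ge0 ?addr_ge0// ltW.
exists (c + 1) => w cw.
have w1 : 1 <= w by lra.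
have gc : g * c = 2 * (`|h| + `|L|) by rewrite /c mulrC divfK// gt_eqF.
have h1 : 2 * (`|h| + `|L|) <= g * w.
  by rewrite -gc ler_pM2l//; lra.
have h2 : (`|h| + `|L|) * w <= g * w ^+ 2 / 2.
  have : 0 <= (g * w - 2 * (`|h| + `|L|)) * w by rewrite mulr_ge0 ?subr_ge0//; lra.
  nra.
have h3 : h * w <= `|h| * w by rewrite ler_wpM2r ?ler_norm//; lra.
have h4 : L <= `|L| := ler_norm L.
have h5 : `|L| <= `|L| * w by rewrite ler_peMr.
lra.
Qed.

(** * Positive correlation *)

(** The threshold is about [b * w] with [w = sqrt (2 ln n)] and [b = 1 - rho / 2]. Since [b < 1],
    the normal tail there exceeds [C / n], so a p-value below the cutoff forces an observation above
    it; since [b ^+ 2 > 1 - rho], deviations of variance at most [1 - rho] rarely get that far. *)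
Lemma hochberg_dependent {R : realType} (rho alpha eta : R) :
  0 < rho -> rho < 1 -> 0 < alpha -> alpha < 1 -> 0 < eta ->
  exists N : nat,
    forall (n : nat) (d : measure_display) (Om : measurableType d) (P : probability Om R)
      (X : 'I_n -> {RV P >-> R}) (mu : 'I_n -> R),
    equicorrelated_normal P X mu rho -> global_null mu -> (N <= n)%N ->
    covered P (hochberg_event X alpha) eta.
Proof.
move=> rho0 rho1 a0 a1 eta0.
have e3 : 0 < eta / 3 by rewrite divr_gt0.
(* Then [1 - Phi tau = (1 + alpha) / 2], strictly above [alpha] as [early_regime] requires. *)
have [tau Ptau] : exists z, Phi z = (1 - alpha) / 2 by apply: Phi_quantile; lra.
have at1 : alpha < 1 - Phi tau by rewrite Ptau; lra.
have [delta [N1 [d0 d1 HA]]] := covered_count tau rho1 e3.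
(* [C / n] bounds the cutoff [alpha / k] as soon as [k > delta * n]. *)
pose C := alpha / delta; have C0 : 0 < C by rewrite divr_gt0.
pose M := 1 / 2 - ln (eta / 3).
have EM : expR (1 / 2 - M) = eta / 3 by rewrite /M opprB addrCA subrr addr0 lnK.
pose b := 1 - rho / 2.
have r0 : 0 < 1 - rho by rewrite subr_gt0.
pose g := b ^+ 2 / (1 - rho) - 1.
have g0 : 0 < g.
  by rewrite subr_gt0 ltr_pdivlMr// mul1r /b; nra.
have b0 : 0 < 1 - b ^+ 2 by rewrite /b; nra.
pose pk : R := normal_peak 1; have pk0 : 0 < pk by rewrite normal_peak_gt0// oner_eq0.
have [w1 hw1] := quadratic_dominates (b * (1 + M) / (1 - rho)) (- ln (eta / 3)) g0.
have [w2 hw2] := quadratic_dominates 0 (ln (C / pk) + 1) b0.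
pose w0 := Num.max 2 (Num.max w1 w2).
have [N2 hN2] := nat_ge (expR (w0 ^+ 2 / 2)).
exists (maxn N1 N2) => n d Om P X mu eqX mu0; rewrite geq_max => /andP[Nn1 Nn2].
have {hN2}n2 := hN2 n Nn2.
have n0 : 0 < n%:R :> R by rewrite (lt_le_trans (expR_gt0 _) n2).
have nn0 : (0 < n)%N by rewrite -(ltr0n R).
pose w := Num.sqrt (2 * ln (n%:R : R)).
have ln0 : w0 ^+ 2 / 2 <= ln (n%:R : R) by rewrite -ler_expR lnK// posrE.
have lnn : 0 <= ln (n%:R : R) by apply: le_trans ln0; rewrite divr_ge0// sqr_ge0.
have w22 : w ^+ 2 = 2 * ln (n%:R : R) by rewrite sqr_sqrtr// mulr_ge0.
have w00 : 0 <= w0 by rewrite le_max ler0n.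
have ww0 : w0 <= w.
  by rewrite -ler_sqr ?nnegrE// ?sqrtr_ge0// w22; lra.
have [w2' [w1w w2w]] : 2 <= w /\ w1 <= w /\ w2 <= w.
  by move: ww0; rewrite /w0 !ge_max => /andP[-> /andP[-> ->]].
have En : n%:R = expR (w ^+ 2 / 2) :> R.
  by rewrite w22 mulrAC divff ?mul1r// lnK// posrE.
(* The shift by 1 offsets the one in [PhiC_lower], which then gives the density at [b * w]. *)
pose z := b * w - 1.
have bh : 1 / 2 < b by rewrite /b; lra.
have z0 : 0 <= z by rewrite /z; nra.
have Cz : C / n%:R < 1 - Phi z.
  apply: (lt_le_trans _ (PhiC_lower z0)).
  rewrite normal_pdfE ?oner_eq0// /normal_fun subr0 /z subrK expr1n -/pk.
  rewrite En -expRN.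
  have hC : C < pk * expR ((1 - b ^+ 2) * w ^+ 2 / 2).
    rewrite mulrC -ltr_pdivrMr// -[ltLHS]lnK ?posrE ?divr_gt0// ltr_expR.
    by have := hw2 w w2w; lra.
  have -> : - (b * w) ^+ 2 / 2 = (1 - b ^+ 2) * w ^+ 2 / 2 + (- (w ^+ 2 / 2)) by field.
  by rewrite expRD mulrA ltr_pM2r ?expR_gt0.
(* Minimizes the leading part [(1 - rho) * kap ^+ 2 / 2 - kap * b * w] of the exponent; with the
   factor [n = expR (w ^+ 2 / 2)] the total is [- g * w ^+ 2 / 2] plus a term linear in [w]. *)
pose kap := b * w / (1 - rho).
have kap0 : 0 < kap by rewrite divr_gt0// mulr_gt0//; lra.
have HC := covered_max z M eqX mu0 rho1 nn0 kap0.
apply: covered_sub (coveredU (HA n d Om P X mu eqX mu0 Nn1) HC).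
  move=> v [k kn nk].
  case: (leP k%:R (n%:R * delta)) => kd.
    by left; apply: early_regime a0 at1 kn nk kd.
  right; move/andP : kn => [k0 kn].
  apply: (some_pvalue kn nk _ Cz).
  rewrite /C ler_pdivlMr// mulrAC ler_pdivrMr ?ltr0n// mulrAC ler_pdivlMr//.
  by rewrite -mulrA ler_pM2l// ltW.
rewrite EM.
suff : n%:R * expR ((1 - rho) * kap ^+ 2 / 2) / expR (kap * (z - M)) <= eta / 3 by lra.
rewrite {1}En -expRN -!expRD -[leRHS]lnK// ler_expR.
have -> : w ^+ 2 / 2 + (1 - rho) * kap ^+ 2 / 2 - kap * (z - M) =
    b * (1 + M) / (1 - rho) * w - g * w ^+ 2 / 2.
  by rewrite /kap /g /z; field; rewrite gt_eqF.
by have := hw1 w w1w; lra.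
Qed.

(** * Zero correlation *)

Section independent.
Context {d : measure_display} {Om : measurableType d} {R : realType}.
Variables (P : probability Om R) (n : nat) (X : 'I_n -> {RV P >-> R}).
Variables (mu : 'I_n -> R).
Hypothesis eqX : equicorrelated_normal P X mu 0.
Hypothesis mu0 : global_null mu.

Lemma prob_some_gt (z : R) :
  measurable [set w | exists j, z < X j w] /\
  P [set w | exists j, z < X j w] = (1 - Phi z ^+ n)%:E.
Proof.
set A := [set w | _].
have EA : A = ~` [set w | forall j, X j w <= z].
  apply/seteqP; split => w /=; first by move=> [j zj] /(_ j); rewrite leNgt zj.
  by move=> /existsNP[j /negP]; rewrite -ltNge; exists j.
have mB := measurable_all_le X z.
split; first by rewrite EA; exact: measurableC.
by rewrite EA probability_setC// (prob_all_le eqX mu0) EFinB.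
Qed.

(** The case [k = n] alone: one p-value at most [alpha / n] suffices, and
    [(1 - alpha / n) ^+ n <= expR (- alpha)]. *)
Lemma hochberg_independent_lower (alpha : R) : (0 < n)%N -> 0 < alpha -> alpha < 1 ->
  ((1 - expR (- alpha))%:E <= P (hochberg_event X alpha))%E.
Proof.
move=> n0 a0 a1; have nR : 0 < n%:R :> R by rewrite ltr0n.
have an : alpha / n%:R < 1.
  by rewrite ltr_pdivrMr// mul1r (lt_le_trans a1)// ler1n.
have [z Pz] : exists z, Phi z = 1 - alpha / n%:R.
  by apply: Phi_quantile; rewrite ?subr_gt0// gtrBl divr_gt0.
have [mA PA] := prob_some_gt z.
have [mE _] := FWER_hochberg X alpha mu0.
apply: (@le_trans _ _ (P [set w | exists j, z < X j w])).
  rewrite PA lee_fin lerD2l lerN2 Pz.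
  have -> : - alpha = n%:R * (- (alpha / n%:R)) by field; rewrite gt_eqF.
  rewrite expRM_natl lerXn2r ?nnegrE ?expR_ge0 ?subr_ge0 ?(ltW an)//.
  exact: expR_ge1Dx.
apply: le_measure; rewrite ?inE// => w [j zj].
exists n; first by rewrite n0 leqnn.
rewrite -[X in (X < _)%N]addn0 ltn_add2l; apply/card_gt0P; exists j.
rewrite inE /pvalue; have := Phi_mono (ltW zj); rewrite Pz; lra.
Qed.

End independent.

(** [k > delta * n] keeps the cutoff below the tail at [z], while [k < n / theta] demands at least
    the fraction [1 - theta^-1] of the p-values under it. *)
Lemma middle_regime {R : realType} (n k : nat) (x : 'I_n -> R) (alpha delta theta z : R) :
  0 < alpha -> 0 < delta -> 1 < theta -> alpha / (delta * n%:R) < 1 - Phi z ->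
  (0 < k <= n)%N ->
  (n < k + #|[pred j | (pvalue (x j) <= alpha / k%:R)%R]|)%N ->
  n%:R * delta < k%:R -> k%:R * theta < n%:R ->
  n%:R * (1 - theta^-1) <= #|[pred j | z < x j]|%:R.
Proof.
move=> a0 d0 t1 az /andP[k0 kn] nk dk kt.
have n0 : (0 < n)%N by exact: leq_trans kn.
have nR : 0 < n%:R :> R by rewrite ltr0n.
have t0 : 0 < theta by rewrite (lt_trans ltr01).
have ak : alpha / k%:R <= alpha / (delta * n%:R).
  rewrite ler_pM2l// lef_pV2 ?posrE ?ltr0n//; last by rewrite mulr_gt0.
  by rewrite mulrC ltW.
have h1 := card_pvalue_le x ak az.
have : n%:R <= k%:R + #|[pred i | (z < x i)%R]|%:R :> R.
  by rewrite -natrD ler_nat; lia.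
rewrite mulrBr mulr1 => h.
have : k%:R <= n%:R / theta by rewrite ler_pdivlMr// ltW.
lra.
Qed.

(** [1 / (1 - x)] equals [1 + x / (1 - x)], at most the exponential of [x / (1 - x)]. *)
Lemma expR_oneB {R : realType} (x : R) : 0 <= x -> x < 1 -> expR (- (x / (1 - x))) <= 1 - x.
Proof.
move=> x0 x1; have y0 : 0 < 1 - x by rewrite subr_gt0.
rewrite expRN -[leRHS]invrK lef_pV2 ?posrE ?expR_gt0 ?invr_gt0//.
apply: le_trans (expR_ge1Dx _).
by rewrite le_eqVlt; apply/orP; left; apply/eqP; field; rewrite gt_eqF.
Qed.

(** Small and middle [k] cost [e / 3] each. For [k >= n / theta] some observation exceeds the
    quantile [z] with tail [a' / n], an event of probability [1 - (1 - t) ^+ n], which is within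
    [e / 3] of the limit. *)
Lemma hochberg_independent_upper {R : realType} (alpha e : R) :
  0 < alpha -> alpha < 1 -> 0 < e ->
  exists N : nat,
    forall (n : nat) (d : measure_display) (Om : measurableType d) (P : probability Om R)
      (X : 'I_n -> {RV P >-> R}) (mu : 'I_n -> R),
    equicorrelated_normal P X mu 0 -> global_null mu -> (N <= n)%N ->
    covered P (hochberg_event X alpha) (1 - expR (- alpha) + e).
Proof.
move=> a0 a1 e0.
have e3 : 0 < e / 3 by rewrite divr_gt0.
(* Gives both [s <= 1] and [21 * s <= e]; the final error [theta ^+ 3 - 1] is at most [7 * s], hence
   at most [e / 3]. *)
pose s := e / (21 + e).
have s0 : 0 < s by rewrite divr_gt0// addr_gt0.
have s1 : s <= 1 by rewrite ler_pdivrMr ?addr_gt0// mul1r lerDr.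
have s7 : 7 * s <= e / 3.
  have : s * 21 <= e.
    by rewrite /s mulrAC ler_pdivrMr ?addr_gt0// ler_pM2l// lerDl ltW.
  lra.
pose theta := 1 + s; have t1 : 1 < theta by rewrite ltrDl.
have t0 : 0 < theta by rewrite (lt_trans ltr01).
(* One factor [theta] comes from [k >= n / theta], the second makes the cutoff strictly smaller than
   the tail at [z]. A third arises below from [1 / (1 - t) <= theta]. *)
pose a' := alpha * theta ^+ 2; have a'0 : 0 < a' by rewrite mulr_gt0// exprn_gt0.
have [tau Ptau] : exists z, Phi z = (1 - alpha) / 2 by apply: Phi_quantile; lra.
have at1 : alpha < 1 - Phi tau by rewrite Ptau; lra.
have [delta [N1 [d0 d1 HA]]] := covered_count tau (ltr01 : (0:R) < 1) e3.
pose ep := 1 - theta^-1.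
have ep0 : 0 < ep by rewrite subr_gt0 invf_lt1.
(* Solves the requirement that the bound of [covered_many] be exactly [e / 3]. *)
pose z0 := 1 / 2 - ln (e / 3 * ep).
have Ez : expR (1 / 2 - z0) / ep = e / 3.
  rewrite /z0 opprB addrCA subrr addr0 lnK ?posrE ?mulr_gt0//.
  by rewrite mulfK// gt_eqF.
have Pz0 : 0 < 1 - Phi z0 by rewrite subr_gt0 Phi_lt1.
have [N2 hN2] := nat_ge (alpha / delta / (1 - Phi z0) + 1).
have [N3 hN3] := nat_ge (a' * theta / s + 1).
exists (maxn 1 (maxn N1 (maxn N2 N3))) => n d Om P X mu eqX mu0.
rewrite !geq_max => /andP[nn0 /andP[Nn1 /andP[/hN2 n2 /hN3 n3]]].
have n0 : 0 < n%:R :> R by rewrite ltr0n.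
have az0 : alpha / (delta * n%:R) < 1 - Phi z0.
  rewrite invfM mulrA ltr_pdivrMr// [ltRHS]mulrC -ltr_pdivrMr//.
  by apply: lt_le_trans n2; rewrite ltrDl.
have a'n : a' * theta < s * n%:R.
  rewrite [ltRHS]mulrC -ltr_pdivrMr//.
  by apply: lt_le_trans n3; rewrite ltrDl.
pose t := a' / n%:R.
have tn0 : 0 < t by rewrite divr_gt0.
have tts : t * theta < s.
  by rewrite /t mulrAC ltr_pdivrMr.
have tt1 : theta * (1 - t) >= 1 by rewrite /theta in tts *; lra.
have tn1 : t < 1 by nra.
have [z Pz] : exists z, Phi z = 1 - t.
  by apply: Phi_quantile; rewrite ?subr_gt0// gtrBl.
have [mC PC] := prob_some_gt eqX mu0 z.
have HC : covered P [set w | exists j, z < X j w] (1 - (1 - t) ^+ n).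
  by exists [set w | exists j, z < X j w] => //; split => //; rewrite PC Pz lexx.
have HB := covered_many z0 eqX mu0 nn0 ep0; rewrite Ez in HB.
apply: covered_sub (coveredU (HA n d Om P X mu eqX mu0 Nn1) (coveredU HB HC)).
  move=> v [k kn nk].
  case: (leP k%:R (n%:R * delta)) => kd.
    by left; apply: early_regime a0 at1 kn nk kd.
  right; case: (ltP (k%:R * theta) n%:R) => kt.
    by left; apply: middle_regime a0 d0 t1 az0 kn nk kd kt.
  right; move/andP : kn => [k0 kn].
  have tlt : alpha * theta / n%:R < 1 - Phi z.
    rewrite Pz opprB addrCA subrr addr0 /t /a' ltr_pM2r ?invr_gt0//.
    by rewrite ltr_pM2l// expr2 ltr_pMl.
  apply: (some_pvalue kn nk _ tlt).
  rewrite ler_pdivlMr// mulrAC ler_pdivrMr ?ltr0n//.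
  by rewrite -mulrA ler_pM2l// mulrC.
suff : expR (- alpha) - e / 3 <= (1 - t) ^+ n by lra.
have h1 : expR (- (alpha * theta ^+ 3)) <= (1 - t) ^+ n.
  apply: (@le_trans _ _ (expR (- (t / (1 - t))) ^+ n)); last first.
    by rewrite lerXn2r ?nnegrE ?expR_ge0 ?expR_oneB ?subr_ge0 ?ltW.
  rewrite -expRM_natl ler_expR mulrN lerN2.
  have -> : n%:R * (t / (1 - t)) = a' / (1 - t).
    by rewrite mulrA [n%:R * t]mulrC divfK// gt_eqF.
  have -> : alpha * theta ^+ 3 = a' * theta by rewrite /a'; ring.
  by rewrite ler_pM2l// -[leLHS]mul1r ler_pdivrMr ?subr_gt0.
apply: le_trans h1.
have -> : - (alpha * theta ^+ 3) = - alpha + - (alpha * (theta ^+ 3 - 1)) by ring.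
rewrite expRD.
have h2 := expR_ge1Dx (- (alpha * (theta ^+ 3 - 1))).
have h3 : alpha * (theta ^+ 3 - 1) <= e / 3.
  apply: le_trans s7; rewrite [leRHS]mulrC.
  have -> : theta ^+ 3 - 1 = s * (3 + 3 * s + s ^+ 2) by rewrite /theta; ring.
  have : s ^+ 2 <= 1 by rewrite expr_le1// ltW.
  move=> ss.
  have : s * (3 + 3 * s + s ^+ 2) <= s * 7 by rewrite ler_pM2l//; lra.
  apply: le_trans; rewrite ler_piMl ?(ltW a1)// mulr_ge0 ?(ltW s0)//.
  by have := sqr_ge0 s; lra.
have h4 : expR (- alpha) <= 1 by rewrite expR_le1 oppr_le0 ltW.
have h5 := expR_gt0 (- alpha).
apply: (@le_trans _ _ (expR (- alpha) * (1 - e / 3))).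
  by rewrite mulrBr mulr1 lerD2l lerN2 ler_piMl// ltW.
by rewrite ler_pM2l//; lra.
Qed.

Theorem theorem4p1 (R : realType) (rho alpha : R)
    (d : nat -> measure_display) (Om : forall n : nat, measurableType (d n))
    (P : forall n : nat, probability (Om n) R)
    (X : forall n : nat, 'I_n -> {RV (P n) >-> R})
    (mu : forall n : nat, 'I_n -> R) :
  0 <= rho -> rho < 1 -> 0 < alpha -> alpha < 1 ->
  (forall n : nat, equicorrelated_normal (P n) (X n) (mu n) rho) ->
  (forall n : nat, global_null (mu n)) ->
  (rho = 0 ->
    exists l : R,
      [/\ FWER (P n) (X n) (mu n) (hochberg n alpha) @[n --> \oo] --> l%:E,
          1 - expR (- alpha) <= l & l <= alpha]) /\
  (0 < rho -> alpha < 1 / 2 ->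
    FWER (P n) (X n) (mu n) (hochberg n alpha) @[n --> \oo] --> 0%:E).
Proof.
move=> _ rho1 a0 a1 eqX mu0.
have mE n := FWER_hochberg (X n) alpha (mu0 n).
split=> [r0|r0 _].
  (* The limit is the lower end of the interval; it is at most [alpha] because
     [expR (- alpha) >= 1 - alpha]. *)
  subst rho; exists (1 - expR (- alpha)); split => //; last first.
    by have := expR_ge1Dx (- alpha); lra.
  apply: cvg_ereal_near => e e0.
  have [N hN] := hochberg_independent_upper a0 a1 e0.
  exists (maxn 1 N) => n; rewrite geq_max => /andP[n0 Nn].
  have [m1 ->] := mE n; split.
    apply: le_trans (hochberg_independent_lower (eqX n) (mu0 n) n0 a0 a1).
    by rewrite lee_fin gerBl ltW.
  by apply: covered_measure => //; exact: hN (eqX n) (mu0 n) Nn.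
apply: cvg_ereal_near => e e0.
have [N hN] := hochberg_dependent r0 rho1 a0 a1 e0.
exists N => n Nn; have [m1 ->] := mE n; split.
  by apply: (@le_trans _ _ 0%E) => //; rewrite lee_fin sub0r oppr_le0 ltW.
by rewrite add0r; apply: covered_measure => //; exact: hN (eqX n) (mu0 n) Nn.
Qed.
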